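(* Let $k$ be a field, $n\ge 1$, and let $0<\alpha<d$ be integers. The Poincaré series of the hyperstar algebra $S_n^{d,\alpha}$ is $$P_{S_n^{d,\alpha}}(t)=\frac{(1+t)^{|V|}}{1-\sum_{i=1}^{n}\beta_i t^{i+1}}=\frac{(1+t)^{n(d-\alpha)+\alpha}}{1-\sum_{i=1}^{n}\binom{n}{i}t^{i+1}},$$ where $V$ is the vertex set of $S_n^{d,\alpha}$ and $\beta_i$ is the $i$-th Betti number of $S_n^{d,\alpha}$ as a module over the polynomial ring $k[V]$.
   Context: For a graded $k$-algebra $R=k[x_1,\ldots,x_N]/I$ ($I$ a homogeneous ideal, standard grading), the Poincaré series is the formal power series $P_R(t)=\sum_{i\ge 0}\dim_k \mathrm{Tor}_i^R(k,k)\,t^i$. The Betti numbers of $R$ over $A=k[x_1,\ldots,x_N]$ are $\beta_i=\dim_k\mathrm{Tor}_i^A(R,k)$. A hypergraph $H=(V,E)$ with $V=\{x_1,\ldots,x_N\}$ and $E\subseteq 2^V$ defines the hypergraph algebra $k[x_1,\ldots,x_N]/(\prod_{x\in e}x : e\in E)$. The same symbol is used for a hypergraph and its algebra. Hyperstar $S_n^{d,\alpha}$: a hypergraph with $n(d-\alpha)+\alpha$ vertices and $n$ edges $e_1,\ldots,e_n$, all of size $d$, with every vertex lying in some edge, such that $|e_i\cap e_j|=|\bigcap_{l=1}^n e_l|=\alpha$ for all $i\ne j$. *)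

(* Defs.v *)
From HB Require Import structures.
From mathcomp Require Import all_boot all_order all_algebra.
From mathcomp Require Import ring_quotient mpoly.
From mathcomp Require boolp.

Set Implicit Arguments.
Unset Strict Implicit.
Unset Printing Implicit Defensive.

Import GRing.Theory.
Local Open Scope ring_scope.
Local Open Scope quotient_scope.

Section PowerSeries.
Variable R : comUnitRingType.
Implicit Types f g : nat -> R.

Definition fps_mul f g : nat -> R :=
  fun n => \sum_(i < n.+1) f i * g (n - i)%N.

(* The first n coefficients of 1/f, by the usual recursion
   g_m = f_0^-1 * ([m = 0] - \sum_(i < m) f_(m - i) * g_i). *)
Fixpoint fps_inv_coefs f (n : nat) : seq R :=
  if n is m.+1 then
    let s := fps_inv_coefs f m in
    rcons s ((f 0%N)^-1 * ((m == 0%N)%:R - \sum_(i < m) f (m - i)%N * s`_i))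
  else [::].

Definition fps_inv f : nat -> R := fun n => (fps_inv_coefs f n.+1)`_n.

Definition fps_div f g : nat -> R := fps_mul f (fps_inv g).

Lemma size_fps_inv_coefs f n : size (fps_inv_coefs f n) = n.
Proof. by elim: n => //= n IHn; rewrite size_rcons IHn. Qed.

Lemma nth_fps_inv_coefs f n i : (i < n)%N ->
  (fps_inv_coefs f n)`_i = fps_inv f i.
Proof.
elim: n => // n IHn; rewrite ltnS leq_eqVlt => /predU1P[->//|lt_in].
by rewrite /= nth_rcons size_fps_inv_coefs lt_in IHn.
Qed.

Lemma fps_mulVf f : f 0%N \is a GRing.unit ->
  fps_mul (fps_inv f) f =1 fun n => (n == 0%N)%:R.
Proof.
move=> f0U n; rewrite /fps_mul big_ord_recr /= subnn.
rewrite {2}/fps_inv /= nth_rcons size_fps_inv_coefs ltnn eqxx.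
rewrite mulrAC mulVr // mul1r addrCA.
rewrite [X in _ + (_ - X)](_ : _ = \sum_(i < n) fps_inv f i * f (n - i)%N).
  by rewrite subrr addr0.
by apply: eq_bigr => i _; rewrite nth_fps_inv_coefs // mulrC.
Qed.

End PowerSeries.

(* The power series expansion of the rational function p / q. *)
Definition poly_ratio (p q : {poly int}) : nat -> int :=
  fps_div (fun i => p`_i) (fun i => q`_i).

(* B as an A-module along f. *)

Definition restrict (A B : comNzRingType) (f : {rmorphism A -> B}) : Type := B.

Section Restrict.
Variables (A B : comNzRingType) (f : {rmorphism A -> B}).

HB.instance Definition _ := GRing.Zmodule.copy (restrict f) B.

Definition restrict_scale (a : A) (b : restrict f) : restrict f :=
  (f a * (b : B) : B).

Lemma restrict_scaleA a b v :
  restrict_scale a (restrict_scale b v) = restrict_scale (a * b) v.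
Proof. by rewrite /restrict_scale rmorphM mulrA. Qed.

Lemma restrict_scale1 : left_id 1 restrict_scale.
Proof. by move=> v; rewrite /restrict_scale rmorph1 mul1r. Qed.

Lemma restrict_scaleDr : right_distributive restrict_scale +%R.
Proof. by move=> a u v; rewrite /restrict_scale mulrDr. Qed.

Lemma restrict_scaleDl v : {morph restrict_scale^~ v : a b / a + b}.
Proof. by move=> a b; rewrite /restrict_scale rmorphD mulrDl. Qed.

HB.instance Definition _ := GRing.Zmodule_isLmodule.Build A (restrict f)
  restrict_scaleA restrict_scale1 restrict_scaleDr restrict_scaleDl.

End Restrict.

(* A resolution  ... -> S^(rk 2) -> S^(rk 1) -> S^(rk 0) -> M -> 0  by free
   modules of finite rank; maps act on row vectors by right multiplication. *)
Record free_resolution (S : comNzRingType) (M : lmodType S) := FreeResolution {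
  res_rk : nat -> nat;
  res_d : forall i, 'M[S]_(res_rk i.+1, res_rk i);
  res_aug : {linear 'rV[S]_(res_rk 0) -> M};
  res_aug_surj : forall m, exists v, res_aug v = m;
  res_exact0 : forall v, res_aug v = 0 <-> exists u, v = u *m res_d 0;
  res_exactS : forall i (v : 'rV[S]_(res_rk i.+1)),
    v *m res_d i = 0 <-> exists u, v = u *m res_d i.+1
}.

Section Tor.
Variables (k : fieldType) (S : comNzRingType) (eps : {rmorphism S -> k}).

Section Homology.
Variables (M : lmodType S) (F : free_resolution M).

(* Here k is an S-module through eps. As S^r (x)_S k = k^r, the differentials
   of F (x)_S k are those of F with eps applied entrywise. *)
Definition res_tensor i : 'M[k]_(res_rk F i.+1, res_rk F i) :=
  map_mx eps (res_d F i).

Definition res_cycles i : 'M[k]_(res_rk F i) :=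
  match i with
  | 0 => 1%:M
  | j.+1 => kermx (res_tensor j)
  end.

Definition homology_dim i : nat :=
  (\rank (res_cycles i) - \rank (res_tensor i))%N.

End Homology.

(* dim_k Tor_i^S(M, k), computed from a chosen resolution; the value does not
   depend on the choice. A resolution by free modules of finite rank exists
   whenever S is noetherian and M is finitely generated; 0 is a junk value. *)
Definition tor_dim (M : lmodType S) (i : nat) : nat :=
  match boolp.pselect (exists F : free_resolution M, True) with
  | left exF => homology_dim (proj1_sig (boolp.cid exF)) i
  | right _ => 0%N
  end.

(* The Poincare series of S with respect to its residue field k = S / ker eps. *)
Definition poincare_series : nat -> int :=
  fun i => (tor_dim (restrict eps) i)%:Z.

End Tor.

(* An empty edge would make the hypergraph algebra the zero ring, over which k
   is not a module. *)
Record hypergraph (N : nat) := Hypergraph {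
  edges :> {set {set 'I_N}};
  set0_notin_edges : set0 \notin edges
}.

(* For n = 1 there are no two distinct edges, and the last condition is void. *)
Definition is_hyperstar (n d a N : nat) (H : hypergraph N) : Prop :=
  [/\ N = (n * (d - a) + a)%N,
      #|edges H| = n,
      forall e, e \in edges H -> #|e| = d,
      cover (edges H) = [set: 'I_N] &
      forall e f, e \in edges H -> f \in edges H -> e != f ->
        #|e :&: f| = #|\bigcap_(g in edges H) g| /\
        #|\bigcap_(g in edges H) g| = a].

Section HypergraphAlgebra.
Variables (k : fieldType) (N : nat).
Local Notation A := {mpoly k[N]}.

Definition poly_aug : {rmorphism A -> k} := meval (fun _ : 'I_N => 0).

Definition edge_monomial (e : {set 'I_N}) : A := \prod_(x in e) 'X_x.

Variable H : hypergraph N.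

Definition edge_ideal (p : A) : bool :=
  boolp.asbool (exists c : {set 'I_N} -> A,
    p = \sum_(e in edges H) c e * edge_monomial e).

Lemma edge_idealP (p : A) : reflect
  (exists c : {set 'I_N} -> A, p = \sum_(e in edges H) c e * edge_monomial e)
  (p \in edge_ideal).
Proof. exact: boolp.asboolP. Qed.

Lemma edge_ideal_aug (p : A) : p \in edge_ideal -> poly_aug p = 0.
Proof.
case/edge_idealP=> c ->; rewrite rmorph_sum big1 // => e eH.
have [x xe] : exists x, x \in e.
  by apply/set0Pn; apply: contraNneq (set0_notin_edges H) => <-.
rewrite rmorphM /edge_monomial (bigD1 x) //= rmorphM /=.
by rewrite mevalXU mul0r mulr0.
Qed.

Lemma edge_ideal_closed : idealr_closed edge_ideal.
Proof.
split.
- by apply/edge_idealP; exists (fun=> 0); rewrite big1 // => e _; rewrite mul0r.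
- apply/negP => /edge_ideal_aug; rewrite rmorph1 => /eqP.
  by rewrite oner_eq0.
- move=> a p q /edge_idealP[c ->] /edge_idealP[c' ->]; apply/edge_idealP.
  exists (fun e => a * c e + c' e); rewrite mulr_sumr -big_split /=.
  by apply: eq_bigr => e _; rewrite mulrDl mulrA.
Qed.

HB.instance Definition _ := isIdealr.Build A edge_ideal edge_ideal_closed.

Definition edge_idealr : idealr A := edge_ideal.

Definition hypergraph_algebra : comNzRingType := {ideal_quot edge_idealr}.

Definition halg_pi : {rmorphism A -> hypergraph_algebra} :=
  \pi_{ideal_quot edge_idealr}.

(* The augmentation k[V] -> k sending all variables to 0, factored through the
   quotient. *)
Definition halg_aug_fun (r : hypergraph_algebra) : k := poly_aug (repr r).

Lemma halg_aug_pi p : halg_aug_fun (halg_pi p) = poly_aug p.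
Proof.
apply/eqP; rewrite -subr_eq0 -rmorphB; apply/eqP/edge_ideal_aug.
by rewrite Quotient.idealrBE reprK.
Qed.

Lemma halg_aug_is_zmod_morphism : zmod_morphism halg_aug_fun.
Proof.
move=> x y; rewrite -[x]reprK -[y]reprK.
by rewrite -[_ - _](rmorphB halg_pi) !halg_aug_pi rmorphB.
Qed.

Lemma halg_aug_is_monoid_morphism : monoid_morphism halg_aug_fun.
Proof.
split; first by rewrite -(rmorph1 halg_pi) halg_aug_pi rmorph1.
move=> x y; rewrite -[x]reprK -[y]reprK.
by rewrite -[_ * _](rmorphM halg_pi) !halg_aug_pi rmorphM.
Qed.

HB.instance Definition _ := GRing.isZmodMorphism.Build
  hypergraph_algebra k halg_aug_fun halg_aug_is_zmod_morphism.
HB.instance Definition _ := GRing.isMonoidMorphism.Build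
  hypergraph_algebra k halg_aug_fun halg_aug_is_monoid_morphism.

Definition halg_aug : {rmorphism hypergraph_algebra -> k} := halg_aug_fun.

(* beta_i = dim_k Tor_i^(k[V])(R, k), with R the hypergraph algebra. *)
Definition betti (i : nat) : nat := tor_dim poly_aug (restrict halg_pi) i.

End HypergraphAlgebra.

(* Main.v *)
Require Import Defs.
From HB Require Import structures.
From mathcomp Require Import all_boot all_order all_algebra.
From mathcomp Require Import ring_quotient mpoly.
From mathcomp Require boolp.

Set Implicit Arguments.
Unset Strict Implicit.
Unset Printing Implicit Defensive.

Import GRing.Theory.
Local Open Scope ring_scope.
Local Open Scope quotient_scope.

(** Let A = k[V]. The edges of a hyperstar are the sets C :|: Y i, where the core
C and the petals Y i are nonempty and disjoint. Hence its algebra is R = A / mJ,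
where m is the monomial of C and J is generated by the monomials y_i of the
petals, which form a regular sequence because their supports are disjoint
([hyperstar_sunflower], [edge_ideal_sunflower]).

As m is a nonzerodivisor, the Koszul complex of y, with its map into degree 0
multiplied by m, is a minimal free resolution of R over A; this gives
beta_i = 'C(n, i) ([tor_dim_multiple]).

For the Poincare series, R is a Golod ring, and the common factor m makes all
Massey operations vanish for suitable representatives. Let K be the Koszul
complex of the variables. Choose z in C and v_i in Y_i; then
e_i = (y_i / x_(v_i)) e_(v_i) has differential y_i. For a nonempty set T of
indices let e_T be the product of the e_i with i in T, and put
  h_T = (m / x_z) e_z d(e_T), up to sign.
Over R this is a cycle of degree #|T|, since its differential is m d(e_T) and
d(e_T) has coefficients in J. Any two such cycles have product zero, since e_z
occurs twice. Their classes form a basis of the homology of K over R in positive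
degrees: the homology of K over A / J is the exterior algebra on the e_i
([quotient_cycles], [quotient_cycles_indep]), and multiplication by m carries it
to the homology over A / mJ ([multiple_cycles], [multiple_cycles_indep]).

Consequently K tensored with the tensor algebra on letters v_T of degree
#|T| + 1, with a differential that sends v_T to h_T, is a resolution of k over R
([golod_exact]). It is minimal because h_T has coefficients in the maximal ideal.
Its basis consists of an exterior monomial and a word in the letters, and
splitting off the first letter yields the recursion for the ranks that the
announced quotient of series satisfies ([size_words], [words_series]). Tor is
defined from an arbitrary resolution, so the comparison theorem is needed to
read it off these two ([tor_dim_minimal]). *)

(** * Quotients of power series *)

Section PowerSeriesRatio.
Variable R : comUnitRingType.
Implicit Types f g h : nat -> R.

(** Truncation moves identities between series to polynomials, where the ring
laws are available. *)
Lemma fps_mul_coef f g m n : (n <= m)%N ->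
  fps_mul f g n = ((\poly_(i < m.+1) f i) * (\poly_(i < m.+1) g i))`_n.
Proof.
move=> le_nm; rewrite coefM; apply: eq_bigr => i _.
rewrite !coef_poly !ltnS (leq_trans (leq_subr _ _) le_nm).
by rewrite (leq_trans _ le_nm) // -ltnS.
Qed.

Lemma eq_fps_mul f f' g g' : f =1 f' -> g =1 g' -> fps_mul f g =1 fps_mul f' g'.
Proof. by move=> ef eg n; apply: eq_bigr => i _; rewrite ef eg. Qed.

Lemma fps_mulC f g : fps_mul f g =1 fps_mul g f.
Proof. by move=> n; rewrite !(@fps_mul_coef _ _ n n) // mulrC. Qed.

Lemma fps_mulA f g h : fps_mul f (fps_mul g h) =1 fps_mul (fps_mul f g) h.
Proof.
move=> n; rewrite [LHS](@fps_mul_coef _ _ n) // [RHS](@fps_mul_coef _ _ n) //.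
pose P (u : nat -> R) := \poly_(i < n.+1) u i.
transitivity ((P f * (P g * P h))`_n); last rewrite mulrA.
  rewrite !coefM; apply: eq_bigr => i _; congr (_ * _).
  by rewrite coef_poly ltnS leq_subr (@fps_mul_coef _ _ n) ?leq_subr.
rewrite !coefM; apply: eq_bigr => i _; congr (_ * _).
by rewrite coef_poly ltn_ord (@fps_mul_coef _ _ n) // -ltnS.
Qed.

Lemma fps_mul1 f : fps_mul f (fun n => (n == 0%N)%:R) =1 f.
Proof.
move=> n; rewrite /fps_mul big_ord_recr /= subnn eqxx mulr1 big1 ?add0r //.
by move=> i _; rewrite subn_eq0 leqNgt ltn_ord mulr0.
Qed.

(** A Poincare series is recognised through this from a recursion on ranks, which
is what a product with the denominator expresses. *)
Lemma fps_div_unique f g h : g 0%N \is a GRing.unit ->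
  fps_mul h g =1 f -> h =1 fps_div f g.
Proof.
move=> gU hg n; rewrite /fps_div -(eq_fps_mul hg (fun=> erefl _)) -fps_mulA.
rewrite (eq_fps_mul (fun=> erefl _) (fps_mulC _ _)).
by rewrite (eq_fps_mul (fun=> erefl _) (fps_mulVf gU)) fps_mul1.
Qed.

End PowerSeriesRatio.

(** * Tor does not depend on the resolution *)

(** Chain maps and homotopies are built one degree at a time; a component can only
be continued if it satisfies an invariant, which is the role of [good]. *)
Lemma dependent_choice_from (T : nat -> Type) (good : forall i, T i -> Prop)
    (rel : forall i, T i -> T i.+1 -> Prop) :
    (exists x, good 0%N x) ->
    (forall i x, good i x -> exists2 y, good i.+1 y & rel i x y) ->
  exists2 x : forall i, T i, good 0%N (x 0%N) & forall i, rel i (x i) (x i.+1).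
Proof.
move=> ex0 exS.
have {}exS i (x : {x | good i x}) : exists y : {y | good i.+1 y},
    rel i (sval x) (sval y).
  by have [y gy rxy] := exS i _ (svalP x); exists (exist _ y gy).
pose s := fix s i : {x | good i x} :=
  match i with
  | 0 => boolp.cid ex0
  | j.+1 => sval (boolp.cid (exS j (s j)))
  end.
exists (fun i => sval (s i)); first exact: svalP.
by move=> i; rewrite /=; exact: (svalP (boolp.cid (exS i (s i)))).
Qed.

Lemma lift_rows (S : comNzRingType) (p q r : nat)
    (A : 'M[S]_(p, q)) (B : 'M_(r, q)) :
  (forall v : 'rV_p, exists u : 'rV_r, v *m A = u *m B) -> exists U, A = U *m B.
Proof.
move=> AB; have [u uP] := boolp.choice AB.
exists (\matrix_i u (delta_mx 0 i)).
by apply/row_matrixP=> i; rewrite row_mul rowK -uP -rowE.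
Qed.

Section Comparison.
Variables (S : comNzRingType) (M : lmodType S).
Implicit Types F G : free_resolution M.

(** The augmentation acts as the differential leaving degree 0, so that exactness
reads the same in every degree. *)
Definition syzygy F i : 'rV[S]_(res_rk F i) -> Prop :=
  match i with
  | 0 => fun v => res_aug F v = 0
  | j.+1 => fun v => v *m res_d F j = 0
  end.

Lemma syzygyP F i (v : 'rV_(res_rk F i)) :
  syzygy v <-> exists u, v = u *m res_d F i.
Proof. by case: i v => [|i] v; [apply: res_exact0 | apply: res_exactS]. Qed.

Lemma res_dd F i : res_d F i.+1 *m res_d F i = 0.
Proof.
apply/row_matrixP=> j; rewrite row0 row_mul; apply/res_exactS.
by exists (delta_mx 0 j); rewrite -rowE.
Qed.

(** The rows of [res_d F i *m phi i] are syzygies of G, hence lift through the next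
differential of G. *)
Lemma chain_lift F G : exists2 phi : forall i, 'M[S]_(res_rk F i, res_rk G i),
  forall v, res_aug G (v *m phi 0%N) = res_aug F v &
  forall i, phi i.+1 *m res_d G i = res_d F i *m phi i.
Proof.
pose good i := match i return 'M[S]_(res_rk F i, res_rk G i) -> Prop with
  | 0 => fun A => forall v, res_aug G (v *m A) = res_aug F v
  | j.+1 => fun A => res_d F j.+1 *m A *m res_d G j = 0
  end.
apply: (@dependent_choice_from _ good
  (fun i A B => B *m res_d G i = res_d F i *m A)).
  have [u uP] := boolp.choice (fun j : 'I_(res_rk F 0) =>
    res_aug_surj G (res_aug F (delta_mx 0 j))).
  exists (\matrix_j u j) => v.
  rewrite mulmx_sum_row linear_sum [in RHS](row_sum_delta v) linear_sum.
  by apply: eq_bigr => j _; rewrite !linearZ rowK uP.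
move=> i A gA; have [B BP] : exists B, res_d F i *m A = B *m res_d G i.
  apply: lift_rows => v; apply/syzygyP; rewrite mulmxA.
  case: i A gA v => [|i] A gA v /=.
    by rewrite gA; apply/res_exact0; exists v.
  by rewrite -2!mulmxA (mulmxA _ A) gA mulmx0.
by exists B => //=; rewrite -mulmxA -BP mulmxA res_dd mul0mx.
Qed.

(** Uniqueness half of the comparison theorem: what remains of theta after
subtracting the part of the homotopy already built consists of syzygies, and
exactness lifts them. *)
Lemma chain_homotopy F (theta : forall i, 'M[S]_(res_rk F i)) :
    (forall v, res_aug F (v *m theta 0%N) = 0) ->
    (forall i, theta i.+1 *m res_d F i = res_d F i *m theta i) ->
  exists2 h : forall i, 'M[S]_(res_rk F i, res_rk F i.+1),
    theta 0%N = h 0%N *m res_d F 0 &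
    forall i, theta i.+1 = res_d F i *m h i + h i.+1 *m res_d F i.+1.
Proof.
move=> th0 thS.
pose good i := match i return 'M[S]_(res_rk F i, res_rk F i.+1) -> Prop with
  | 0 => fun h => theta 0%N = h *m res_d F 0
  | j.+1 => fun h => theta j.+2 *m res_d F j.+1 = res_d F j.+1 *m h *m res_d F j.+1
  end.
apply: (@dependent_choice_from _ good
  (fun i h h' => theta i.+1 = res_d F i *m h + h' *m res_d F i.+1)).
  have [|h hP] := @lift_rows _ _ _ _ (theta 0%N) (res_d F 0); last by exists h.
  by move=> v; apply/res_exact0.
move=> i h gh.
have [|h' hP] := @lift_rows _ _ _ _ (theta i.+1 - res_d F i *m h) (res_d F i.+1).
  move=> v; apply/res_exactS; rewrite -mulmxA mulmxBl thS.
  case: i h gh v => [|i] h /= gh v; first by rewrite gh mulmxA subrr mulmx0.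
  by rewrite -thS gh subrr mulmx0.
exists h'; last by rewrite -hP addrC subrK.
rewrite /= -[res_d F i.+1 *m h' *m _]mulmxA -hP mulmxBr mulmxA res_dd mul0mx.
by rewrite subr0 thS.
Qed.

Variables (k : fieldType) (eps : {rmorphism S -> k}).

(** A vector of Z that f sends into B' lies in B, because g brings it back to itself
modulo B. Dimensions are compared through a complement of B' in Z': its image
under g, together with B, contains Z. *)
Lemma rank_quotient_le (p q a b c e : nat)
    (Z : 'M[k]_(a, p)) (B : 'M[k]_(b, p)) (Z' : 'M[k]_(c, q)) (B' : 'M[k]_(e, q))
    (f : 'M[k]_(p, q)) (g : 'M[k]_(q, p)) :
    (Z *m f <= Z')%MS -> (B' <= Z')%MS -> (B' *m g <= B)%MS ->
    (Z *m (f *m g - 1%:M) <= B)%MS ->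
  (\rank Z - \rank B <= \rank Z' - \rank B')%N.
Proof.
move=> Zf BZ' Bg Zfg; rewrite leq_subLR.
have -> : (\rank Z' - \rank B' = \rank (Z' :\: B')%MS)%N.
  rewrite -(mxrank_cap_compl Z' B') (_ : \rank (Z' :&: B') = \rank B').
    by rewrite addKn.
  by apply/eqmx_rank/andP; rewrite capmxSr sub_capmx BZ' /=.
have Zle : (Z <= B + (Z' :\: B') *m g)%MS.
  rewrite -[Z](subrK (Z *m f *m g)) addmx_sub //.
    rewrite (submx_trans _ (addsmxSl _ _)) // -opprB eqmx_opp.
    by move: Zfg; rewrite mulmxBr mulmx1 mulmxA.
  rewrite (submx_trans (submxMr g Zf)) //.
  have : (Z' <= (Z' :\: B') + (Z' :&: B'))%MS by rewrite addsmx_diff_cap_eq.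
  move/(submxMr g)/submx_trans; apply; rewrite addsmxMr.
  rewrite addsmx_sub addsmxSr (submx_trans _ (addsmxSl _ _)) //.
  by rewrite (submx_trans _ Bg) // submxMr // capmxSr.
rewrite (leq_trans (mxrankS Zle)) // (leq_trans (mxrank_adds_leqif _ _)) //.
by rewrite leq_add2l mxrankM_maxl.
Qed.

Lemma res_cyclesP F i : (res_tensor eps F i <= res_cycles eps F i)%MS.
Proof.
case: i => [|i] /=; first by rewrite submx1.
by apply/sub_kermxP; rewrite -map_mxM res_dd map_mx0.
Qed.

(** The homotopy between [phi i *m psi i] and the identity survives the base change
to k, so the homology computed from F embeds into that computed from G. *)
Lemma homology_dim_le F G i : (homology_dim eps F i <= homology_dim eps G i)%N.
Proof.
have [phi phi0 phiS] := chain_lift F G.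
have [psi psi0 psiS] := chain_lift G F.
pose theta i := phi i *m psi i - 1%:M.
have [||h h0 hS] := @chain_homotopy F theta.
- by move=> v; rewrite mulmxBr mulmx1 mulmxA linearB /= psi0 phi0 subrr.
- move=> j; rewrite mulmxBl mulmxBr mul1mx mulmx1 -mulmxA psiS !mulmxA.
  by rewrite phiS.
pose f i := map_mx eps (phi i); pose g i := map_mx eps (psi i).
have fS j : f j.+1 *m res_tensor eps G j = res_tensor eps F j *m f j.
  by rewrite -!map_mxM phiS.
have gS j : g j.+1 *m res_tensor eps F j = res_tensor eps G j *m g j.
  by rewrite -!map_mxM psiS.
have thetaE j : f j *m g j - 1%:M = map_mx eps (theta j).
  by rewrite map_mxB map_mxM map_mx1.
rewrite /homology_dim; apply: (rank_quotient_le (f := f i) (g := g i)).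
- case: i => [|i]; first by rewrite /= submx1.
  by apply/sub_kermxP; rewrite -mulmxA fS mulmxA mulmx_ker mul0mx.
- exact: res_cyclesP.
- by rewrite -gS submxMl.
- rewrite thetaE; case: i => [|i].
    by rewrite h0 map_mxM mulmxA submxMl.
  rewrite hS map_mxD !map_mxM mulmxDr mulmxA mulmx_ker mul0mx add0r mulmxA.
  exact: submxMl.
Qed.

(** Exchanging the resolutions in [homology_dim_le] shows that any of them may be
used; for a minimal one every vector is a cycle and no nonzero one a boundary. *)
Lemma tor_dim_minimal F i : (forall j, res_tensor eps F j = 0) ->
  tor_dim eps M i = res_rk F i.
Proof.
move=> F0; rewrite /tor_dim; case: boolp.pselect => [exF|[]]; last by exists F.
set G := proj1_sig _.
have -> : homology_dim eps G i = homology_dim eps F i.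
  by apply/eqP; rewrite eqn_leq !homology_dim_le.
rewrite /homology_dim F0 mxrank0 subn0; case: i => [|i] /=; first exact: mxrank1.
by rewrite F0 mxrank_ker mxrank0 subn0.
Qed.

End Comparison.
(** * Resolutions given by a graded basis *)

(** With functions on a graded set B of basis vectors, a differential is a single
formula for all degrees; the matrices are recovered degree by degree. The values
of [D f] in degree p depend only on those of f in degree p + 1: this is how
[D_local] says that D lowers degrees by one, and it allows functions with infinite
support. *)
Section GradedBasis.
Variables (S C : comNzRingType) (phi : {rmorphism S -> C}).
Variables (B : eqType) (b0 : B) (deg : B -> nat) (bas : nat -> seq B).
Variable D : (B -> S) -> B -> S.
Hypothesis bas_uniq : forall p, uniq (bas p).
Hypothesis mem_bas : forall p b, (b \in bas p) = (deg b == p).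
Hypothesis bas0 : bas 0 = [:: b0].
Hypothesis D_local : forall f g b,
  (forall b', deg b' = (deg b).+1 -> f b' = g b') -> D f b = D g b.
Hypothesis D_linear : forall a f g b,
  D (fun b' => a * f b' + g b') b = a * D f b + D g b.
Hypothesis D_square : forall f b, D (D f) b = 0.
Hypothesis D_exact : forall p f, (forall b, deg b <> p.+1 -> f b = 0) ->
  (forall b, D f b = 0) -> exists u, forall b, deg b = p.+1 -> f b = D u b.
Hypothesis phi_surj : forall c, exists s, phi s = c.
Hypothesis phi_ker : forall s, phi s = 0 <-> exists u, s = D u b0.

Definition basis_row p (f : B -> S) : 'rV[S]_(size (bas p)) :=
  \row_j f (nth b0 (bas p) j).

Definition row_fun p (v : 'rV[S]_(size (bas p))) (b : B) : S :=
  \sum_j v 0 j * (nth b0 (bas p) j == b)%:R.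

Lemma deg_nth_bas p (j : 'I_(size (bas p))) : deg (nth b0 (bas p) j) = p.
Proof. by apply/eqP; rewrite -mem_bas mem_nth. Qed.

Lemma row_fun_nth p (v : 'rV_(size (bas p))) (j : 'I_(size (bas p))) :
  row_fun v (nth b0 (bas p) j) = v 0 j.
Proof.
rewrite /row_fun (bigD1 j) //= eqxx mulr1 big1 ?addr0 // => i ne_ij.
by rewrite nth_uniq // (inj_eq val_inj) (negPf ne_ij) mulr0.
Qed.

Lemma row_funK p (v : 'rV_(size (bas p))) : basis_row p (row_fun v) = v.
Proof. by apply/rowP => j; rewrite mxE row_fun_nth. Qed.

Lemma basis_rowK p f b : deg b = p -> row_fun (basis_row p f) b = f b.
Proof.
move/eqP; rewrite -mem_bas -index_mem => lt_b.
have -> : b = nth b0 (bas p) (Ordinal lt_b) by rewrite /= nth_index // -index_mem.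
by rewrite row_fun_nth mxE.
Qed.

Lemma row_fun_out p (v : 'rV_(size (bas p))) b : deg b <> p -> row_fun v b = 0.
Proof.
move=> nb; rewrite /row_fun big1 // => j _; case: eqP => [eb|]; last by rewrite mulr0.
by case: nb; rewrite -eb deg_nth_bas.
Qed.

Lemma row_fun_linear p a (u v : 'rV_(size (bas p))) b :
  row_fun (a *: u + v) b = a * row_fun u b + row_fun v b.
Proof.
rewrite /row_fun mulr_sumr -big_split; apply: eq_bigr => j _ /=.
by rewrite !mxE mulrDl mulrA.
Qed.

Lemma basis_diff0 b : D (fun=> 0) b = 0.
Proof.
transitivity (- 1 * D (fun=> 0) b + D (fun=> 0) b); last by rewrite mulN1r addNr.
by rewrite -D_linear; apply: D_local => b' _; rewrite mulr0 addr0.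
Qed.

Lemma basis_diff_out f b : (forall b', deg b' = (deg b).+1 -> f b' = 0) ->
  D f b = 0.
Proof. by move=> f0; rewrite -(basis_diff0 b); apply: D_local. Qed.

Definition basis_mx p : 'M[S]_(size (bas p.+1), size (bas p)) :=
  lin1_mx (fun v => basis_row p (D (row_fun v))).

Lemma mul_basis_mx p (v : 'rV_(size (bas p.+1))) :
  v *m basis_mx p = basis_row p (D (row_fun v)).
Proof.
have lin : linear (fun v : 'rV_(size (bas p.+1)) => basis_row p (D (row_fun v))).
  move=> a u w; apply/rowP=> j; rewrite !mxE -D_linear.
  by apply: D_local => b _; apply: row_fun_linear.
pose mk := GRing.isLinear.Build _ _ _ _ _ lin.
pose L : {linear _ -> _} := HB.pack (fun v : 'rV_(size (bas p.+1)) =>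
  basis_row p (D (row_fun v))) mk.
exact: (mul_rV_lin1 L v).
Qed.

Lemma mul_basis_mx_row p f : basis_row p.+1 f *m basis_mx p = basis_row p (D f).
Proof.
rewrite mul_basis_mx; apply/rowP=> j; rewrite !mxE; apply: D_local => b.
by rewrite deg_nth_bas => /basis_rowK ->.
Qed.

Definition basis_aug (v : 'rV[S]_(size (bas 0))) : restrict phi :=
  phi (row_fun v b0).

Lemma basis_aug_linear : linear basis_aug.
Proof.
by move=> a u v; rewrite /basis_aug row_fun_linear rmorphD rmorphM.
Qed.

HB.instance Definition _ := GRing.isLinear.Build S _ (restrict phi) _ basis_aug
  basis_aug_linear.

Lemma deg_b0 : deg b0 = 0%N.
Proof. by apply/eqP; rewrite -mem_bas bas0 mem_head. Qed.

Lemma basis_aug_surj m : exists v, basis_aug v = m.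
Proof.
have [s <-] := phi_surj m; exists (basis_row 0 (fun=> s)).
by rewrite /basis_aug basis_rowK // deg_b0.
Qed.

Lemma basis_exact0 v : basis_aug v = 0 <-> exists u, v = u *m basis_mx 0.
Proof.
rewrite [_ = 0]phi_ker; split=> [[u vu]|[u ->]].
  exists (basis_row 1 u); rewrite mul_basis_mx_row -[v]row_funK.
  apply/rowP=> j; rewrite !mxE.
  suff -> : nth b0 (bas 0) j = b0 by [].
  by apply/eqP; rewrite -mem_seq1 -bas0 mem_nth.
by exists (row_fun u); rewrite mul_basis_mx basis_rowK // deg_b0.
Qed.

Lemma basis_exactS p (v : 'rV_(size (bas p.+1))) :
  v *m basis_mx p = 0 <-> exists u, v = u *m basis_mx p.+1.
Proof.
split=> [|[u ->]].
  rewrite mul_basis_mx => /rowP Dv0.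
  have [b nb|b|u vu] := @D_exact p (row_fun v).
  - exact: row_fun_out.
  - have [db|nb] := eqVneq (deg b) p.
      rewrite -(basis_rowK (D (row_fun v)) db) /row_fun big1 // => j _.
      by rewrite Dv0 mxE mul0r.
    by apply: basis_diff_out => b' db'; apply: row_fun_out => e; case/eqP: nb;
      apply: succn_inj; rewrite -db'.
  exists (basis_row p.+2 u); rewrite mul_basis_mx_row -[v]row_funK.
  by apply/rowP=> j; rewrite !mxE vu // deg_nth_bas.
rewrite [u *m _]mul_basis_mx mul_basis_mx_row.
by apply/rowP=> j; rewrite !mxE D_square.
Qed.

Definition basis_resolution : free_resolution (restrict phi) :=
  FreeResolution basis_aug_surj basis_exact0 basis_exactS.

Lemma tor_dim_basis (k : fieldType) (eps : {rmorphism S -> k}) i :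
  (forall f b, eps (D f b) = 0) -> tor_dim eps (restrict phi) i = size (bas i).
Proof.
move=> D_minimal; apply: (@tor_dim_minimal _ _ _ _ basis_resolution) => j.
by apply/matrixP=> r c; rewrite !mxE D_minimal.
Qed.

End GradedBasis.

(** * Exterior and interior multiplication *)

(** An element of a Koszul complex is a function f on the subsets of the index set;
[f T] is the coefficient of the product e_T of the e_j, j in T, in increasing order.
Then [wedge j] is left multiplication by e_j and [contract j] is contraction with
the dual vector. The anticommutation relations between them are the only property
of the signs that later arguments use. *)
Section Koszul.
Variables (S : comNzRingType) (n : nat).
Local Notation K := {ffun {set 'I_n} -> S^o}.
Implicit Types (f g : K) (T : {set 'I_n}) (i j : 'I_n).

(** The sign produced by moving e_j from the left to its place among the factors of
e_T. *)
Definition kosz_sign j T : S := (-1) ^+ #|[set i in T | (i < j)%N]|.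

Definition contract j f : K :=
  [ffun T : {set 'I_n} => if j \in T then 0 else kosz_sign j T * f (j |: T)].

Definition wedge j f : K :=
  [ffun T : {set 'I_n} => if j \in T then kosz_sign j T * f (T :\ j) else 0].

Definition degree_sign T : S := (-1) ^+ #|T|.

(** The degree involution, which turns left multiplications into right ones. *)
Definition kosz_parity f : K := [ffun T : {set 'I_n} => degree_sign T * f T].

Lemma contract_linear j : linear (contract j).
Proof.
move=> a f g; apply/ffunP=> T; rewrite !ffunE.
by case: ifP => _; rewrite ?scaler0 ?addr0 // mulrDr mulrCA.
Qed.

Lemma wedge_linear j : linear (wedge j).
Proof.
move=> a f g; apply/ffunP=> T; rewrite !ffunE.
by case: ifP => _; rewrite ?scaler0 ?addr0 // mulrDr mulrCA.
Qed.

Lemma kosz_parity_linear : linear kosz_parity.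
Proof. by move=> a f g; apply/ffunP=> T; rewrite !ffunE mulrDr mulrCA. Qed.

HB.instance Definition _ j :=
  GRing.isLinear.Build S K K _ (contract j) (contract_linear j).
HB.instance Definition _ j :=
  GRing.isLinear.Build S K K _ (wedge j) (wedge_linear j).
HB.instance Definition _ :=
  GRing.isLinear.Build S K K _ kosz_parity kosz_parity_linear.

Lemma kosz_signK j T : kosz_sign j T * kosz_sign j T = 1.
Proof. by rewrite -expr2 sqrr_sign. Qed.

Lemma kosz_signU i j T : j \notin T ->
  kosz_sign i (j |: T) = (-1) ^+ (j < i)%N * kosz_sign i T.
Proof.
move=> jT; rewrite /kosz_sign -exprD; congr (_ ^+ _).
case: ltnP => [lt_ji|le_ij].
  rewrite (_ : [set _ in _ | _] = j |: [set l in T | (l < i)%N]).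
    by rewrite cardsU1 inE (negPf jT).
  by apply/setP=> l; rewrite !inE; case: eqVneq => // ->; rewrite lt_ji.
rewrite add0n; congr #|pred_of_set _|.
by apply/setP=> l; rewrite !inE; case: eqVneq => // ->; rewrite (negPf jT) ltnNge le_ij.
Qed.

Lemma kosz_signU1 j T : kosz_sign j (j |: T) = kosz_sign j T.
Proof.
congr (_ ^+ #|pred_of_set _|).
by apply/setP=> l; rewrite !inE; case: eqVneq => // ->; rewrite ltnn !andbF.
Qed.

Lemma kosz_signD1 j T : kosz_sign j (T :\ j) = kosz_sign j T.
Proof.
case: (boolP (j \in T)) => [/setD1K {2}<-|jT]; first by rewrite kosz_signU1.
by rewrite (setDidPl _) // disjoint_sym disjoints1.
Qed.

Lemma sign_ltn i j : i != j ->
  (-1) ^+ (j < i)%N = - (-1) ^+ (i < j)%N :> S.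
Proof.
by rewrite -(inj_eq val_inj) /=; case: ltngtP => //= _ _; rewrite ?expr0 ?expr1 ?opprK.
Qed.

Lemma kosz_sign_swap i j T : i != j -> i \notin T -> j \notin T ->
  kosz_sign i T * kosz_sign j (i |: T) = - (kosz_sign j T * kosz_sign i (j |: T)).
Proof.
move=> ne_ij iT jT; rewrite !kosz_signU // (sign_ltn ne_ij) mulNr mulrN opprK.
by rewrite [LHS]mulrCA [RHS]mulrCA (mulrC (kosz_sign i T)).
Qed.

Lemma contract_contract j f : contract j (contract j f) = 0.
Proof. by apply/ffunP=> T; rewrite !ffunE setU11 mulr0 if_same. Qed.

Lemma contract_eq0 j f T : contract j f = 0 -> j \in T -> f T = 0.
Proof.
move=> /ffunP/(_ (T :\ j)) + jT; rewrite !ffunE setD11 setD1K //.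
by move/(congr1 ( *%R (kosz_sign j (T :\ j)))); rewrite mulrA kosz_signK mul1r mulr0.
Qed.

Lemma contractC i j f : contract i (contract j f) = - contract j (contract i f).
Proof.
have [->|ne_ij] := eqVneq i j; first by rewrite contract_contract oppr0.
apply/ffunP=> T; rewrite !ffunE !inE (eq_sym j) (negPf ne_ij) /=.
case: (boolP (i \in T)) => iT; case: (boolP (j \in T)) => jT //=;
  rewrite ?mulr0 ?oppr0 // !mulrA -mulNr.
by rewrite kosz_sign_swap // setUCA.
Qed.

Lemma wedge_wedge j f : wedge j (wedge j f) = 0.
Proof. by apply/ffunP=> T; rewrite !ffunE setD11 mulr0 if_same. Qed.

Lemma wedgeC i j f : wedge i (wedge j f) = - wedge j (wedge i f).
Proof.
have [->|ne_ij] := eqVneq i j; first by rewrite wedge_wedge oppr0.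
apply/ffunP=> T; rewrite !ffunE !inE (eq_sym j) (negPf ne_ij) /=.
case: (boolP (i \in T)) => iT; case: (boolP (j \in T)) => jT //=;
  rewrite ?mulr0 ?oppr0 // !mulrA -mulNr.
have -> : T :\ j :\ i = T :\ i :\ j by apply/setP=> l; rewrite !inE andbCA.
congr (_ * _); set U := T :\ i :\ j.
have iU : i \notin U by rewrite !inE eqxx andbF.
have jU : j \notin U by rewrite !inE eqxx.
have Ti : T :\ i = j |: U by rewrite setD1K // !inE eq_sym ne_ij.
have Tj : T :\ j = i |: U.
  by rewrite -(setD1K iT) Ti; apply/setP=> l; rewrite !inE;
    have [->|] := eqVneq l j; rewrite ?(eq_sym j) ?(negPf ne_ij).
rewrite -(kosz_signD1 i T) -(kosz_signD1 j T) Ti Tj !kosz_signU1.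
by rewrite [LHS]mulrC [in RHS]mulrC kosz_sign_swap // eq_sym.
Qed.

Lemma contract_wedge j f : contract j (wedge j f) = f - wedge j (contract j f).
Proof.
apply/ffunP=> T; rewrite !ffunE setU11 setD11.
case: ifPn => jT.
  by rewrite kosz_signD1 setD1K // mulrA kosz_signK mul1r subrr.
by rewrite kosz_signU1 mulrA kosz_signK mul1r subr0 setU1K.
Qed.

Lemma contract_wedgeC i j f : i != j ->
  contract i (wedge j f) = - wedge j (contract i f).
Proof.
move=> ne_ij; apply/ffunP=> T; rewrite !ffunE !inE (eq_sym j) (negPf ne_ij) /=.
case: (boolP (i \in T)) => iT; case: (boolP (j \in T)) => jT //=;
  rewrite ?mulr0 ?oppr0 // !mulrA -mulNr.
have -> : (i |: T) :\ j = i |: (T :\ j).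
  by apply/setP=> l; rewrite !inE; have [->|] := eqVneq l j;
    rewrite ?(eq_sym j) ?(negPf ne_ij).
congr (_ * _); rewrite -(setD1K jT) !setU1K ?setD11 //; set U := T :\ j.
have iU : i \notin U by rewrite !inE (negPf iT) andbF.
have jU : j \notin U by rewrite !inE eqxx.
rewrite setUCA !kosz_signU1 (kosz_signU _ iU) (kosz_signU _ jU).
rewrite (sign_ltn ne_ij) !mulNr -mulrA (mulrCA (kosz_sign i U)).
by rewrite signrMK mulrC.
Qed.

Lemma parity_contract j f : kosz_parity (contract j f) = - contract j (kosz_parity f).
Proof.
apply/ffunP=> T; rewrite !ffunE; case: ifPn => jT; first by rewrite mulr0 oppr0.
by rewrite /degree_sign cardsU1 jT add1n exprS mulN1r mulNr mulrN opprK mulrCA.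
Qed.

Lemma parity_wedge j f : kosz_parity (wedge j f) = - wedge j (kosz_parity f).
Proof.
apply/ffunP=> T; rewrite !ffunE; case: ifPn => jT; last by rewrite mulr0 oppr0.
by rewrite /degree_sign (cardsD1 j T) jT add1n exprS mulN1r mulNr mulrCA.
Qed.

Lemma kosz_parityK f : kosz_parity (kosz_parity f) = f.
Proof. by apply/ffunP=> T; rewrite !ffunE signrMK. Qed.

End Koszul.

(** * Koszul complexes of regular families *)

Section KoszulDifferential.
Variables (S : comNzRingType) (n : nat) (y : 'I_n -> S).
Local Notation K := {ffun {set 'I_n} -> S^o}.
Implicit Types (f g u : K) (T : {set 'I_n}) (i j : 'I_n) (s : seq 'I_n).

(** Partial families s are allowed since the proofs add generators one at a time. *)
Definition kosz_d s f : K := \sum_(j <- s) y j *: contract j f.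

Lemma kosz_d_linear s : linear (kosz_d s).
Proof.
move=> a f g; rewrite /kosz_d scaler_sumr -big_split /=; apply: eq_bigr => j _.
by rewrite linearP scalerDr !scalerA mulrC.
Qed.

HB.instance Definition _ s :=
  GRing.isLinear.Build S K K _ (kosz_d s) (kosz_d_linear s).

Lemma kosz_d_cons i s f :
  kosz_d (i :: s) f = y i *: contract i f + kosz_d s f.
Proof. exact: big_cons. Qed.

Lemma contract_d i s f : contract i (kosz_d s f) = - kosz_d s (contract i f).
Proof.
rewrite linear_sum -sumrN; apply: eq_bigr => j _.
by rewrite linearZ /= contractC scalerN.
Qed.

Lemma kosz_dd s f : kosz_d s (kosz_d s f) = 0.
Proof.
elim: s => [|i s IHs] in f *; first exact: big_nil.
rewrite !kosz_d_cons (linearD (contract i)) (linearD (kosz_d s)) /=.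
rewrite (linearZ_LR (contract i)) (linearZ_LR (kosz_d s)) /= contract_contract.
by rewrite scaler0 add0r IHs addr0 contract_d scalerN addNr.
Qed.

Lemma kosz_d_wedge i s f : uniq s ->
  kosz_d s (wedge i f) = (i \in s)%:R * y i *: f - wedge i (kosz_d s f).
Proof.
elim: s => [|j s IHs /andP[js us]].
  by rewrite /kosz_d !big_nil linear0 mul0r scale0r subr0.
rewrite !kosz_d_cons {}IHs // inE (linearD (wedge i)) (linearZ_LR (wedge i)) /=.
have [->|ne_ij] := eqVneq i j.
  rewrite (negPf js) mul0r scale0r sub0r mul1r contract_wedge scalerBr.
  by rewrite opprD addrA.
by rewrite contract_wedgeC 1?eq_sym //= scalerN opprD addrCA.
Qed.

Lemma parity_d s f : kosz_parity (kosz_d s f) = - kosz_d s (kosz_parity f).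
Proof.
rewrite linear_sum -sumrN; apply: eq_bigr => j _.
by rewrite linearZ /= parity_contract scalerN.
Qed.

Definition in_ideal s (a : S) : Prop :=
  exists c : 'I_n -> S, a = \sum_(j <- s) c j * y j.

Lemma in_ideal0 s : in_ideal s 0.
Proof. by exists (fun=> 0); rewrite big1 // => j _; rewrite mul0r. Qed.

Lemma in_idealD s a b : in_ideal s a -> in_ideal s b -> in_ideal s (a + b).
Proof.
move=> [c ->] [c' ->]; exists (fun j => c j + c' j); rewrite -big_split.
by apply: eq_bigr => j _; rewrite mulrDl.
Qed.

Lemma in_ideal_gen s j a : uniq s -> j \in s -> in_ideal s (a * y j).
Proof.
move=> us js; exists (fun l => a * (l == j)%:R).
rewrite (bigD1_seq j) //= eqxx mulr1 big1 ?addr0 // => l /negPf ->.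
by rewrite mulr0 mul0r.
Qed.

(** A regular sequence in every order of the indices, properness of the ideal
being left out. *)
Definition regular_family :=
  forall s i a, uniq (i :: s) -> in_ideal s (y i * a) -> in_ideal s a.

Lemma in_ideal_d s f T : in_ideal s (kosz_d s f T).
Proof.
exists (fun j => contract j f T); rewrite /kosz_d sum_ffunE.
by apply: eq_bigr => j _; rewrite [LHS]ffunE; apply: mulrC.
Qed.

(** The part of f that is free of e_i. *)
Definition drop_index i f : K := contract i (wedge i f).

Lemma drop_index_linear i : linear (drop_index i).
Proof. by move=> a f g; rewrite /drop_index !linearP. Qed.

HB.instance Definition _ i :=
  GRing.isLinear.Build S K K _ (drop_index i) (drop_index_linear i).

Lemma drop_indexE i f : f = drop_index i f + wedge i (contract i f).
Proof. by rewrite /drop_index contract_wedge subrK. Qed.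

Lemma drop_index_id i f : contract i f = 0 -> drop_index i f = f.
Proof. by rewrite /drop_index contract_wedge => ->; rewrite linear0 subr0. Qed.

Lemma contract_drop i f : contract i (drop_index i f) = 0.
Proof. exact: contract_contract. Qed.

Lemma contract_dropC i j f : i != j ->
  contract j (drop_index i f) = drop_index i (contract j f).
Proof.
move=> ne; rewrite /drop_index contractC contract_wedgeC 1?eq_sym //.
by rewrite linearN opprK.
Qed.

Lemma drop_index_d i s f : uniq s -> i \notin s ->
  drop_index i (kosz_d s f) = kosz_d s (drop_index i f).
Proof.
move=> us /negPf is_; rewrite /drop_index.
have := kosz_d_wedge i f us; rewrite is_ mul0r scale0r add0r => e.
by rewrite -[wedge i _]opprK -e (linearN (contract i)) /= contract_d opprK.
Qed.

(** If the b_j are free of the e_l with l in s, then the differential of the sum of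
the e_j b_j is the sum of the y_j b_j. *)
Lemma contracted_boundary s g : uniq s -> {in s, forall j, contract j g = 0} ->
  (forall T, in_ideal s (g T)) -> exists v, g = kosz_d s v.
Proof.
move=> us cg /boolp.choice[c cP].
have gs T : has (mem T) s -> g T = 0.
  by case/hasP=> j js jT; apply: contract_eq0 (cg j js) jT.
pose b j : K := [ffun T : {set 'I_n} => if has (mem T) s then 0 else c T j].
have db j : kosz_d s (b j) = 0.
  rewrite /kosz_d big_seq big1 // => l ls.
  suff -> : contract l (b j) = 0 by rewrite scaler0.
  apply/ffunP=> T; rewrite !ffunE; case: ifP => // _.
  by rewrite (introT hasP) ?mulr0 //; exists l; rewrite ?inE ?eqxx.
exists (\sum_(j <- s) wedge j (b j)); rewrite linear_sum big_seq /=.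
rewrite (eq_bigr (fun j => y j *: b j)) => [|j js]; last first.
  by rewrite kosz_d_wedge // db linear0 subr0 js mul1r.
rewrite -big_seq; apply/ffunP=> T; rewrite sum_ffunE.
case: (boolP (has (mem T) s)) => sT.
  by rewrite gs // big1 // => j _; rewrite !ffunE sT scaler0.
by rewrite cP; apply: eq_bigr => j _; rewrite !ffunE (negPf sT); apply: mulrC.
Qed.

(** Write f = f0 + e_i f1. Up to boundaries, the coefficients of f1 are multiplied by
y_i into the ideal of s, so by regularity they belong to it and f1 is a boundary
d u. Adding the differential of e_i u to f leaves a cycle for s free of e_i. *)
Lemma koszul_cycle s f : regular_family -> uniq s -> kosz_d s f = 0 ->
  exists g u, f = g + kosz_d s u /\ {in s, forall j, contract j g = 0}.
Proof.
move=> reg; elim: s => [|i s IHs] in f *.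
  by exists f, 0; rewrite linear0 addr0.
move=> uis; have /andP[is_ us] := uis; rewrite kosz_d_cons => df.
have c_id : kosz_d s (contract i f) = 0.
  have := congr1 (contract i) df.
  rewrite linear0 (linearD (contract i)) (linearZ_LR (contract i)) /=.
  by rewrite contract_contract scaler0 add0r contract_d => /eqP; rewrite oppr_eq0 => /eqP.
have {}df : kosz_d s f = - (y i *: contract i f).
  by apply/eqP; rewrite -addr_eq0 addrC df.
have drop_c : drop_index i (contract i f) = contract i f.
  by rewrite drop_index_id // contract_contract.
have d_drop : kosz_d s (drop_index i f) = - (y i *: contract i f).
  by rewrite -drop_index_d // df linearN (linearZ_LR (drop_index i)) /= drop_c.
have drop_ne j : j \in s -> i != j by apply: contraTneq => <-.
have [u [du cu]] : exists u, contract i f = kosz_d s u /\ contract i u = 0.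
  have [g [u [gu cg]]] := IHs _ us c_id.
  have {}gu : contract i f = drop_index i g + kosz_d s (drop_index i u).
    by rewrite -drop_index_d // -linearD -gu.
  have [||v gv] := @contracted_boundary s (drop_index i g) us.
  - by move=> j js; rewrite contract_dropC ?cg ?linear0 ?drop_ne.
  - move=> T; apply: (reg s i) => //.
    have -> : y i * drop_index i g T =
        kosz_d s (- (drop_index i f + y i *: drop_index i u)) T.
      rewrite linearN (linearD (kosz_d s)) (linearZ_LR (kosz_d s)) /= d_drop.
      rewrite -scalerN -scalerDr -scalerN opprD opprK gu addrK.
      by rewrite [RHS]ffunE.
    exact: in_ideal_d.
  exists (drop_index i (v + drop_index i u)); split; last exact: contract_drop.
  by rewrite -drop_index_d // (linearD (kosz_d s)) /= -gv -gu drop_c.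
pose w := drop_index i f + y i *: u.
have cw : contract i w = 0.
  rewrite (linearD (contract i)) (linearZ_LR (contract i)) /= cu contract_drop.
  by rewrite scaler0 addr0.
have [|g [v [gv cg]]] := IHs w us.
  by rewrite (linearD (kosz_d s)) (linearZ_LR (kosz_d s)) /= d_drop -du addNr.
exists (drop_index i g), (drop_index i v - wedge i u); split.
  have {}gv : w = drop_index i g + kosz_d s (drop_index i v).
    by rewrite -drop_index_d // -(linearD (drop_index i)) /= -gv drop_index_id.
  rewrite linearB /= kosz_d_wedge // mem_head mul1r !kosz_d_cons contract_drop.
  rewrite cu scaler0 !add0r -du addrA -gv /w opprB addrA addrAC addrK.
  exact: drop_indexE.
move=> j; rewrite inE => /predU1P[->|js]; first exact: contract_drop.
by rewrite contract_dropC ?cg ?linear0 ?drop_ne.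
Qed.

Definition kosz1 : K := [ffun T : {set 'I_n} => (T == set0)%:R].

Lemma contract_kosz1 j : contract j kosz1 = 0.
Proof.
apply/ffunP=> T; rewrite !ffunE; case: ifP => // _.
by rewrite (_ : _ == _ = false) ?mulr0 //; apply/set0Pn; exists j; rewrite setU11.
Qed.

Lemma kosz_d_kosz1 s : kosz_d s kosz1 = 0.
Proof. by apply: big1 => j _; rewrite contract_kosz1 scaler0. Qed.

Lemma in_ideal_boundary s a : uniq s -> in_ideal s a ->
  exists u, a *: kosz1 = kosz_d s u.
Proof.
move=> us [c ->]; exists (\sum_(j <- s) c j *: wedge j kosz1).
rewrite scaler_suml linear_sum !big_seq; apply: eq_bigr => j js.
rewrite (linearZ_LR (kosz_d s)) /= kosz_d_wedge // js mul1r kosz_d_kosz1.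
by rewrite linear0 subr0 scalerA.
Qed.

Lemma kosz_d_local s f g T :
  (forall T', #|T'| = #|T|.+1 -> f T' = g T') -> kosz_d s f T = kosz_d s g T.
Proof.
move=> fg; rewrite /kosz_d !sum_ffunE; apply: eq_bigr => j _; rewrite !ffunE.
by case: ifPn => // jT; rewrite fg // cardsU1 jT.
Qed.

Theorem koszul_exact f : regular_family -> kosz_d (enum 'I_n) f = 0 ->
  exists a u, f = a *: kosz1 + kosz_d (enum 'I_n) u.
Proof.
move=> reg /(koszul_cycle reg (enum_uniq _))[g [u [-> cg]]].
exists (g set0), u; congr (_ + _); apply/ffunP=> T; rewrite !ffunE.
have [->|[j jT]] := set_0Vmem T; first by rewrite eqxx [_ *: _]mulr1.
rewrite (contract_eq0 (cg j (mem_enum _ j)) jT).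
by rewrite (_ : _ == _ = false) ?scaler0 //; apply/set0Pn; exists j.
Qed.

End KoszulDifferential.

(** * Koszul homology of an ideal and of its multiples *)

Section SubsetsOfSequence.
Variable I : finType.

(** In this order, sums over subsets split along an induction on s. *)
Fixpoint subsets_of (s : seq I) : seq {set I} :=
  if s is i :: s' then subsets_of s' ++ [seq i |: T | T <- subsets_of s']
  else [:: set0].

Lemma mem_subsets_of s T : (T \in subsets_of s) = (T \subset s).
Proof.
elim: s T => [|i s IHs] T.
  rewrite inE; apply/eqP/subsetP => [-> j|sT]; first by rewrite inE.
  by apply/setP=> j; rewrite inE; apply/negP => /sT.
rewrite mem_cat IHs; apply/orP/idP.
  case=> [/subsetP sT|/mapP[U]].
    by apply/subsetP=> j /sT js; rewrite inE js orbT.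
  rewrite IHs => /subsetP sU ->; apply/subsetP=> j; rewrite !inE.
  by case: eqP => //= _ /sU.
move=> /subsetP sT; case: (boolP (i \in T)) => iT; [right|left].
  apply/mapP; exists (T :\ i); last by rewrite setD1K.
  rewrite IHs; apply/subsetP=> j; rewrite !inE => /andP[ne_ji jT].
  by have := sT j jT; rewrite inE (negPf ne_ji).
apply/subsetP=> j jT; have := sT j jT; rewrite inE => /predU1P[eji|//].
by rewrite -eji jT in iT.
Qed.

Lemma notin_subsets_of i s T : i \notin s -> T \in subsets_of s -> i \notin T.
Proof. by move=> is_; rewrite mem_subsets_of => /subsetP sT; apply: contra is_ => /sT. Qed.

Lemma uniq_subsets_of s : uniq s -> uniq (subsets_of s).
Proof.
elim: s => //= i s IHs /andP[is_ /IHs us]; rewrite cat_uniq us /=.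
rewrite map_inj_in_uniq ?us ?andbT => [|T U sT sU eTU]; last first.
  by rewrite -(setU1K (notin_subsets_of is_ sT)) eTU setU1K // (notin_subsets_of is_).
apply/hasPn=> _ /mapP[T _ ->]; apply/negP => /(notin_subsets_of is_).
by rewrite setU11.
Qed.

Lemma perm_subsets_of : perm_eq (subsets_of (enum I)) (enum {set I}).
Proof.
apply: uniq_perm; rewrite ?uniq_subsets_of ?enum_uniq // => T.
by rewrite mem_subsets_of mem_enum; apply/subsetP=> j _; rewrite mem_enum.
Qed.

End SubsetsOfSequence.

(** Right multiplications make the signs disappear. If [theta] is the degree
involution and [e i] is right multiplication by an element e_i of degree 1 with
differential y_i, then [e i] commutes with d up to [y i *: theta]. Therefore the
commutator [rmul_d] of d with right multiplication by a product e_T of the e_i is,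
up to [theta], right multiplication by d(e_T), and it anticommutes with d for
every T. *)
Section RightMultiplication.
Variables (A : comNzRingType) (K : lmodType A).
Variables (d theta : {linear K -> K}).
Variables (I : finType) (y : I -> A) (e : I -> {linear K -> K}).
Implicit Types (f g : K) (s : seq I) (T : {set I}).

Fixpoint rmul s T f : K :=
  if s is i :: s' then if i \in T then e i (rmul s' T f) else rmul s' T f
  else f.

Lemma rmul_linear s T : linear (rmul s T).
Proof. by elim: s => //= i s IHs a f g; case: ifP; rewrite IHs ?linearP. Qed.

HB.instance Definition _ s T :=
  GRing.isLinear.Build A K K _ (rmul s T) (rmul_linear s T).

Definition rmul_d s T f : K := d (rmul s T f) - rmul s T (d f).

Lemma rmul_d_linear s T : linear (rmul_d s T).
Proof.
move=> a f g; rewrite /rmul_d (linearP (rmul s T)) !(linearP d) /=.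
by rewrite (linearP (rmul s T)) /= opprD addrACA -scalerBr.
Qed.

HB.instance Definition _ s T :=
  GRing.isLinear.Build A K K _ (rmul_d s T) (rmul_d_linear s T).

Hypothesis dd : forall f, d (d f) = 0.
Hypothesis d_e : forall i f, d (e i f) = y i *: theta f + e i (d f).

Lemma rmul_d_anti s T f : d (rmul_d s T f) = - rmul_d s T (d f).
Proof. by rewrite /rmul_d (linearB d) /= !dd linear0 sub0r subr0. Qed.

(** The coefficients of d(e_T) lie in the ideal generated by the y_i. *)
Lemma rmul_d_annihilated (m : A) s T f : (forall i, m * y i = 0) ->
  m *: rmul_d s T f = 0.
Proof.
move=> my; elim: s => [|i s IHs] /=; first by rewrite /rmul_d subrr scaler0.
rewrite /rmul_d /=; case: ifP => _ //.
rewrite d_e -addrA -(linearB (e i)) /= -/(rmul_d s T f) scalerDr scalerA my.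
by rewrite scale0r add0r -(linearZ_LR (e i)) /= IHs linear0.
Qed.

Variables (mu z : A) (ez : {linear K -> K}).
Hypothesis d_ez : forall f, d (ez f) = z *: theta f + ez (d f).
Hypothesis ez_ez : forall f, ez (ez f) = 0.
Hypothesis ez_e : forall i f, ez (e i f) = - e i (ez f).
Hypothesis theta_e : forall i f, theta (e i f) = - e i (theta f).
Hypothesis theta_ez : forall f, theta (ez f) = - ez (theta f).

Lemma ez_rmul_ez s T f : ez (rmul s T (ez f)) = 0.
Proof.
by elim: s => [|i s IHs] //=; case: ifP; rewrite ?ez_e ?IHs ?linear0 ?oppr0.
Qed.

Lemma theta_rmul_ez s T f : theta (rmul s T (ez f)) = - ez (rmul s T (theta f)).
Proof.
elim: s => [|i s IHs] //=; case: ifP => // _.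
by rewrite theta_e IHs ez_e linearN.
Qed.

(** This is the derivative of the identity [ez_rmul_ez]. *)
Lemma ez_rmul_d_ez s T f : ez (rmul_d s T (ez f)) = 0.
Proof.
rewrite /rmul_d linearB d_ez (linearD (rmul s T)) (linearZ_LR (rmul s T)) /=.
rewrite (linearD ez) (linearZ_LR ez) ez_rmul_ez addr0.
have := d_ez (rmul s T (ez f)).
rewrite ez_rmul_ez linear0 theta_rmul_ez scalerN => /esym/eqP.
by rewrite addrC subr_eq0 => /eqP ->; rewrite subrr.
Qed.

(** Up to sign, right multiplication by mu e_z d(e_T). The sign is such that the
image of 1 has differential mu z d(e_T). *)
Definition golod_op T f : K := - mu *: rmul_d (enum I) T (ez f).

Lemma golod_op_linear T : linear (golod_op T).
Proof.
move=> a f g; rewrite /golod_op (linearP ez) (linearP (rmul_d (enum I) T)) /=.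
by rewrite scalerDr !scalerA mulrC.
Qed.

HB.instance Definition _ T :=
  GRing.isLinear.Build A K K _ (golod_op T) (golod_op_linear T).

Lemma golod_op0 f : golod_op set0 f = 0.
Proof.
have rmul0 g : rmul (enum I) set0 g = g.
  by elim: (enum I) => //= i s ->; rewrite inE.
by rewrite /golod_op /rmul_d !rmul0 subrr scaler0.
Qed.

Lemma golod_op_op T T' f : golod_op T (golod_op T' f) = 0.
Proof.
by rewrite /golod_op (linearZ_LR ez) /= ez_rmul_d_ez scaler0 linear0 scaler0.
Qed.

(** Over a ring where mu * z annihilates the y_i the first term vanishes, and
[golod_op T] anticommutes with d. *)
Lemma d_golod_op T f : d (golod_op T f) =
  (mu * z) *: rmul_d (enum I) T (theta f) - golod_op T (d f).
Proof.
rewrite /golod_op (linearZ_LR d) /= rmul_d_anti d_ez scaleNr scalerN opprK.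
rewrite (linearD (rmul_d _ T)) (linearZ_LR (rmul_d _ T)) /= scalerDr scalerA.
by rewrite scaleNr opprK.
Qed.

End RightMultiplication.

(** K stands for the Koszul complex of the variables, y for a family that is regular
on K, and J for the ideal that it generates. The homology of K / JK is the exterior
algebra over k on the classes of the e_i. Working over A, with membership in JK
expressed by [in_span], avoids a quotient ring for each partial family. *)
Section CompleteIntersection.
Variables (k : fieldType) (A : comNzRingType) (iota : {rmorphism k -> A}).
Variables (K : lmodType A) (d theta : {linear K -> K}) (one : K).
Variables (I : finType) (y : I -> A) (e : I -> {linear K -> K}).
Implicit Types (f g u v w : K) (s : seq I) (T : {set I}) (c : {set I} -> k).

Definition in_span s f : Prop :=
  exists c : I -> K, f = \sum_(j <- s) y j *: c j.

Hypothesis d_one : d one = 0.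
Hypothesis dd : forall f, d (d f) = 0.
Hypothesis thetaK : forall f, theta (theta f) = f.
Hypothesis theta_d : forall f, theta (d f) = - d (theta f).
Hypothesis d_e : forall i f, d (e i f) = y i *: theta f + e i (d f).
Hypothesis d_exact :
  forall f, d f = 0 -> exists a u, f = iota a *: one + d u.
Hypothesis one_indep :
  forall s a u, in_span s (iota a *: one + d u) -> a = 0.
Hypothesis y_regular :
  forall s i f, uniq (i :: s) -> in_span s (y i *: f) -> in_span s f.

Lemma in_span0 s : in_span s 0.
Proof. by exists (fun=> 0); rewrite big1 // => j _; rewrite scaler0. Qed.

Lemma in_spanD s f g : in_span s f -> in_span s g -> in_span s (f + g).
Proof.
move=> [c ->] [c' ->]; exists (fun j => c j + c' j); rewrite -big_split.
by apply: eq_bigr => j _; rewrite scalerDr.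
Qed.

Lemma in_span_map s (h : {linear K -> K}) f : in_span s f -> in_span s (h f).
Proof.
move=> [c ->]; exists (fun j => h (c j)); rewrite linear_sum.
by apply: eq_bigr => j _; rewrite linearZ_LR.
Qed.

Lemma in_spanZ s a f : in_span s f -> in_span s (a *: f).
Proof.
move=> [c ->]; exists (fun j => a *: c j); rewrite scaler_sumr.
by apply: eq_bigr => j _; rewrite !scalerA mulrC.
Qed.

Lemma in_spanN s f : in_span s f -> in_span s (- f).
Proof. by rewrite -scaleN1r; apply: in_spanZ. Qed.

Lemma in_spanB s f g : in_span s f -> in_span s g -> in_span s (f - g).
Proof. by move=> sf sg; apply: in_spanD => //; apply: in_spanN. Qed.

Lemma in_span_sum s (J : Type) (r : seq J) (P : pred J) (F : J -> K) :
  (forall j, P j -> in_span s (F j)) -> in_span s (\sum_(j <- r | P j) F j).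
Proof. by move=> sF; elim/big_ind: _ => //; [apply: in_span0 | apply: in_spanD]. Qed.

Lemma in_span_uncons i s f : in_span (i :: s) f ->
  exists g w, in_span s g /\ f = g + y i *: w.
Proof.
move=> [c ->]; exists (\sum_(j <- s) y j *: c j), (c i).
by rewrite big_cons addrC; split=> //; exists c.
Qed.

Lemma in_span_cons i s g w : uniq (i :: s) -> in_span s g ->
  in_span (i :: s) (g + y i *: w).
Proof.
move=> /andP[is_ us] [c ->]; exists (fun j => if j == i then w else c j).
rewrite big_cons eqxx addrC; congr (_ + _).
rewrite !big_seq; apply: eq_bigr => j js.
by case: eqP => // eji; rewrite -eji js in is_.
Qed.

Lemma in_span_consr i s f : uniq (i :: s) -> in_span s f -> in_span (i :: s) f.
Proof. by move=> us sf; rewrite -[f]addr0 -(scaler0 _ (y i)); apply: in_span_cons. Qed.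

Definition wedges s T : K := rmul e s T one.

Lemma wedges_setU1 i s T : i \notin s -> wedges s (i |: T) = wedges s T.
Proof.
rewrite /wedges; elim: s => //= j s IHs; rewrite inE negb_or.
by case/andP=> ne_ij /IHs->; rewrite !inE eq_sym (negPf ne_ij).
Qed.

Lemma d_wedges s T : uniq s -> in_span s (d (wedges s T)).
Proof.
rewrite /wedges; elim: s => [|i s IHs] us /=.
  by rewrite d_one; apply: in_span0.
have /IHs sT := proj2 (andP us); case: ifP => _; last exact: in_span_consr.
by rewrite d_e addrC; apply: in_span_cons => //; apply: in_span_map.
Qed.

Definition wedge_comb s c : K := \sum_(T <- subsets_of s) iota (c T) *: wedges s T.

Lemma wedge_comb_cons i s c : i \notin s ->
  wedge_comb (i :: s) c =
  wedge_comb s c + e i (wedge_comb s (fun T => c (i |: T))).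
Proof.
move=> is_; rewrite /wedge_comb big_cat big_map linear_sum /=.
congr (_ + _); rewrite !big_seq; apply: eq_bigr => T sT.
  by rewrite {1}/wedges /= (negPf (notin_subsets_of is_ sT)).
by rewrite {1}/wedges /= setU11 -/(wedges _ _) wedges_setU1 // linearZ_LR.
Qed.

Lemma d_wedge_comb s c : uniq s -> in_span s (d (wedge_comb s c)).
Proof.
move=> us; rewrite /wedge_comb linear_sum; apply: in_span_sum => T _.
by rewrite linearZ_LR; apply/in_spanZ/d_wedges.
Qed.

(** One step in the long exact sequence of multiplication by y_i: if
[d f = v + y i *: theta w] with v in the span of s, then w and f - w e_i are cycles
modulo that span, and the induction hypothesis applies to both. *)
Lemma quotient_cycles s f : uniq s -> in_span s (d f) ->
  exists c u, in_span s (f - wedge_comb s c - d u).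
Proof.
elim: s => [|i s IHs] in f *.
  move=> _ [c]; rewrite big_nil => /d_exact[a [u ->]].
  exists (fun=> a), u; rewrite /wedge_comb big_seq1 /= -addrA -opprD subrr.
  exact: in_span0.
move=> us; have /andP[is_ us'] := us.
move=> /in_span_uncons[v [w0 [sv]]]; rewrite -[w0]thetaK.
move: (theta w0) => w {w0} dfE.
have sdw : in_span s (d w).
  rewrite -[d w]thetaK; apply: in_span_map; apply: (y_regular us).
  have := congr1 d dfE; rewrite dd (linearD d) (linearZ_LR d) /= => /esym/eqP.
  rewrite addr_eq0 => /eqP dv; rewrite theta_d scalerN -dv.
  exact: in_span_map.
have [b [u' sw]] := IHs _ us' sdw.
have [|c [u sf]] := IHs (f - e i w) us'.
  rewrite (linearB d) /= d_e dfE opprD addrA addrK.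
  by apply: in_spanB => //; apply: in_span_map.
exists (fun T => if i \in T then b (T :\ i) else c T), (u + e i u').
have -> : wedge_comb (i :: s) (fun T => if i \in T then b (T :\ i) else c T) =
    wedge_comb s c + e i (wedge_comb s b).
  rewrite wedge_comb_cons //; congr (_ + e i _); rewrite /wedge_comb !big_seq;
    apply: eq_bigr => T /(notin_subsets_of is_) iT.
    by rewrite (negPf iT).
  by rewrite setU11 setU1K.
have -> : f - (wedge_comb s c + e i (wedge_comb s b)) - d (u + e i u') =
    (f - e i w - wedge_comb s c - d u + e i (w - wedge_comb s b - d u'))
      + y i *: - theta u'.
  rewrite !(linearB (e i)) (linearD d) /= d_e scalerN !opprD !addrA.
  by rewrite [RHS](ACl (1*3*6*4*8*7*(2*5))) /= addNr addr0.
apply: in_span_cons => //; apply: in_spanD => //; exact: in_span_map.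
Qed.

(** Write the combination as P + Q e_i. Differentiating shows by regularity that Q is
a boundary modulo the span of s, so its coefficients vanish; what is left shows
the same for P, once [quotient_cycles] has turned the multiple of y_i into a
boundary. *)
Lemma quotient_cycles_indep s c u : uniq s ->
  in_span s (wedge_comb s c + d u) -> {in subsets_of s, forall T, c T = 0}.
Proof.
elim: s => [|i s IHs] in c u *.
  move=> _; rewrite /wedge_comb big_seq1 /= => /one_indep c0 T.
  by rewrite inE => /eqP ->.
move=> us; have /andP[is_ us'] := us.
rewrite wedge_comb_cons //; set P := wedge_comb s c; set Q := wedge_comb s _.
move=> /in_span_uncons[v [w [sv PQ]]].
have cU : {in subsets_of s, forall T, c (i |: T) = 0}.
  apply: (IHs _ (theta w)) => //; rewrite -/Q -[Q + _]thetaK.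
  apply: in_span_map; apply: (y_regular us).
  have -> : y i *: theta (Q + d (theta w)) = d v - d P - e i (d Q).
    have dPQ : d P + (y i *: theta Q + e i (d Q)) = d v + y i *: d w.
      have := congr1 d PQ.
      by rewrite !(linearD d) (linearZ_LR d) /= dd d_e addr0.
    apply/eqP; rewrite linearD theta_d thetaK scalerDr scalerN subr_eq.
    by rewrite addrAC (addrAC (d v)) -dPQ (addrC (d P)) !addrK.
  apply: in_spanB; last by apply/in_span_map/d_wedge_comb.
  by apply: in_spanB; [apply: in_span_map | apply: d_wedge_comb].
have Q0 : Q = 0.
  by rewrite /Q /wedge_comb big_seq big1 // => T sT; rewrite cU // rmorph0 scale0r.
move: PQ; rewrite Q0 linear0 addr0 -[w]thetaK; move: (theta w) => {}w PQ.
have [|b [u' sw]] := @quotient_cycles s w us'.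
  rewrite -[d w]thetaK; apply: in_span_map; apply: (y_regular us).
  have := in_spanB (in_span_map d sv) (d_wedge_comb c us').
  suff -> : d v - d P = y i *: theta (d w) by [].
  have := congr1 d PQ; rewrite !(linearD d) (linearZ_LR d) /= dd addr0 => ->.
  by rewrite opprD addrA subrr sub0r theta_d scalerN.
have cs : {in subsets_of s, forall T, c T = 0}.
  apply: (IHs c (u - e i (wedge_comb s b) - e i (d u'))) => //; rewrite -/P.
  have -> : P + d (u - e i (wedge_comb s b) - e i (d u')) =
      v + y i *: theta (w - wedge_comb s b - d u') - e i (d (wedge_comb s b)).
    rewrite !(linearB d) /= !d_e dd linear0 addr0 !(linearB theta) !scalerBr /=.
    rewrite !addrA -PQ !(opprD, opprK) !addrA.
    by rewrite [RHS](ACl (1*2*3*5*4)).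
  apply: in_spanB; last by apply/in_span_map/d_wedge_comb.
  by apply: in_spanD => //; apply/in_spanZ/in_span_map.
move=> T; rewrite mem_cat => /orP[/cs //|/mapP[U sU ->]]; exact: cU.
Qed.

Variables (m mu z : A) (ez : {linear K -> K}).
Hypothesis m_inj : forall f, m *: f = 0 -> f = 0.
Hypothesis d_ez : forall f, d (ez f) = z *: theta f + ez (d f).
Hypothesis m_mu : m = mu * z.
Hypothesis theta_one : theta one = one.

Local Notation golod_cycle T := (golod_op d e mu ez T one).

Lemma d_golod_cycle T : d (golod_cycle T) = m *: d (wedges (enum I) T).
Proof.
rewrite (d_golod_op e dd mu d_ez) theta_one d_one linear0 subr0 -m_mu.
by rewrite /rmul_d d_one linear0 subr0.
Qed.

Lemma wedge_comb_enum c :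
  wedge_comb (enum I) c = \sum_T iota (c T) *: wedges (enum I) T.
Proof. by rewrite /wedge_comb (perm_big _ (perm_subsets_of I)) big_enum. Qed.

Lemma d_golod_comb c :
  d (\sum_T iota (c T) *: golod_cycle T) = m *: d (wedge_comb (enum I) c).
Proof.
rewrite wedge_comb_enum !(linear_sum d) scaler_sumr; apply: eq_bigr => T _.
by rewrite [LHS]linearZ_LR /= d_golod_cycle [d (_ *: _)]linearZ_LR /= !scalerA mulrC.
Qed.

(** Since m is regular, w is a cycle of K, hence a boundary d u1; then u1 is a cycle
modulo JK, and [quotient_cycles] expresses it by the e_T. As [golod_op T] sends 1 to
an element with differential m d(e_T), the same coefficients work for g. *)
Lemma multiple_cycles g w : in_span (enum I) w -> d g = m *: w ->
  exists c a u j, in_span (enum I) j /\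
    g = \sum_T iota (c T) *: golod_cycle T + iota a *: one + d u + m *: j.
Proof.
move=> sw dg; have us := enum_uniq I.
have dw0 : d w = 0 by apply: m_inj; rewrite -linearZ_LR -dg dd.
have [b [u1 wE]] := d_exact dw0.
have b0 : b = 0 by apply: (@one_indep (enum I) b u1); rewrite -wE.
move: wE; rewrite b0 rmorph0 scale0r add0r => wE.
have [|c [u2 sj]] := @quotient_cycles (enum I) u1 us; first by rewrite -wE.
set j := u1 - _ - _ in sj.
have [|a [u gE]] := @d_exact (g - \sum_T iota (c T) *: golod_cycle T - m *: j).
  rewrite !(linearB d) (linearZ_LR d) /= d_golod_comb dg wE -!scalerBr.
  by rewrite /j !(linearB d) /= dd subr0 subrr scaler0.
exists c, a, u, j; split=> //.
by rewrite -[_ + iota a *: one + _]addrA -gE [_ + (_ - _)]addrC addrAC !subrK.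
Qed.

(** Differentiating and cancelling m turns the relation into one between the e_T in
K / JK. The empty set is an exception because [golod_op set0] is zero. *)
Lemma multiple_cycles_indep c u j : in_span (enum I) j ->
  \sum_T iota (c T) *: golod_cycle T + d u = m *: j ->
  forall T, T != set0 -> c T = 0.
Proof.
move=> sj eqj; have us := enum_uniq I.
have [|a [u' jE]] := @d_exact (wedge_comb (enum I) c - j).
  apply: m_inj; rewrite (linearB d) scalerBr /= -d_golod_comb -(linearZ_LR d) /=.
  by rewrite -eqj (linearD d) /= dd addr0 subrr.
(* the constant is absorbed by the coefficient of the empty product *)
pose c' T := c T - if T == set0 then a else 0.
have c'E : wedge_comb (enum I) c' = wedge_comb (enum I) c - iota a *: one.
  rewrite !wedge_comb_enum.
  rewrite (eq_bigr (fun T => iota (c T) *: wedges (enum I) T -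
    if T == set0 then iota a *: one else 0)) => [|T _].
    by rewrite sumrB -big_mkcond big_pred1_eq.
  rewrite /c' rmorphB scalerBl; congr (_ - _); case: eqP => [->|_].
    by congr (_ *: _); rewrite /wedges; elim: (enum I) => //= i s ->; rewrite inE.
  by rewrite rmorph0 scale0r.
move=> T /negPf T0; have := @quotient_cycles_indep (enum I) c' (- u') us _ T.
rewrite c'E linearN mem_subsets_of /c' T0 subr0; apply.
  suff -> : wedge_comb (enum I) c - iota a *: one + - d u' = j by [].
  by rewrite -addrA -opprD -jE opprB addrC subrK.
by apply/subsetP=> i _; rewrite mem_enum.
Qed.

End CompleteIntersection.

(** * The Golod complex *)

(** If the positive homology of K has a basis represented by elements h_l(1) such
that all products h_l h_l' vanish, no Massey operations are needed to resolve k.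
An element of K tensored with the tensor algebra on the letters is stored as the
function that sends a word to its coefficient in K; the differential looks one
letter ahead, so that no finiteness of the support is required. *)
Section GolodComplex.
Variables (k : fieldType) (S : comNzRingType) (iota : {rmorphism k -> S}).
Variables (K : lmodType S) (d : {linear K -> K}) (one : K).
Variables (L : finType) (h : L -> {linear K -> K}).
Hypothesis dd : forall g, d (d g) = 0.
Hypothesis d_one : d one = 0.
Hypothesis dh : forall l g, d (h l g) = - h l (d g).
Hypothesis hh : forall l l' g, h l (h l' g) = 0.
Hypothesis h_span : forall g, d g = 0 -> exists (b : L -> k) a u,
  g = \sum_l iota (b l) *: h l one + iota a *: one + d u.
Hypothesis h_indep : forall (c : L -> k) u,
  \sum_l iota (c l) *: h l one + d u = 0 -> forall l, c l = 0.

Definition golod_d (f : seq L -> K) (w : seq L) : K :=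
  d (f w) + \sum_l h l (f (l :: w)).

Lemma golod_dd f w : golod_d (golod_d f) w = 0.
Proof.
rewrite /golod_d linearD dd add0r linear_sum -big_split big1 //= => l _.
rewrite dh linearD linear_sum big1 => [|l' _]; last by rewrite /= hh.
by rewrite addr0 addNr.
Qed.

Lemma golod_dD f g w :
  golod_d (fun v => f v + g v) w = golod_d f w + golod_d g w.
Proof.
rewrite /golod_d linearD addrACA -big_split; congr (_ + _).
by apply: eq_bigr => l _; rewrite linearD.
Qed.

(** Removing the last letter l of all words turns f into a cycle with shorter words,
which by induction is a boundary up to a constant a_l. Once these boundaries are
subtracted, the only coefficients left are one at the empty word and the a_l at
the one-letter words. The differential makes the sum of the a_l h_l(1) a boundary
of K, so the a_l vanish by [h_indep], and [h_span] applies to the cycle of K that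
remains. *)
Lemma golod_exact p f : (forall w, (p <= size w)%N -> f w = 0) ->
    (forall w, golod_d f w = 0) ->
  exists a u, forall w, f w = (if w is [::] then iota a *: one else 0) + golod_d u w.
Proof.
elim: p f => [|p IHp] f f_small df.
  exists 0, (fun=> 0) => w; rewrite f_small // /golod_d linear0 big1 => [|l _].
    by rewrite rmorph0 scale0r !addr0; case: w.
  by rewrite linear0.
have IH l : exists au : k * (seq L -> K), forall w,
    f (rcons w l) = (if w is [::] then iota au.1 *: one else 0) + golod_d au.2 w.
  have [||a [u fu]] := IHp (fun w => f (rcons w l)).
  - by move=> w le_pw; apply: f_small; rewrite size_rcons.
  - by move=> w; rewrite -[RHS](df (rcons w l)).
  by exists (a, u).
have {IH} [au fau] := boolp.choice IH.
(* the primitives found for the various last letters, put together *)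
pose U w := if w is x :: v then (au (last x v)).2 (belast x v) else 0.
have U_rcons w l : U (rcons w l) = (au l).2 w.
  by case: w => //= x w; rewrite last_rcons belast_rcons.
have fU w l : f (rcons w l) =
    (if w is [::] then iota (au l).1 *: one else 0) + golod_d U (rcons w l).
  rewrite fau; congr (_ + _); rewrite /golod_d U_rcons; congr (_ + _).
  by apply: eq_bigr => l' _; rewrite -rcons_cons U_rcons.
pose g := f [::] - golod_d U [::].
have dg : \sum_l iota (au l).1 *: h l one + d g = 0.
  have := df [::]; rewrite {1}/golod_d.
  have -> : f [::] = g + golod_d U [::] by rewrite subrK.
  rewrite (eq_bigr (fun l => iota (au l).1 *: h l one + h l (golod_d U [:: l])))
    => [|l _]; last by rewrite (fU [::] l) linearD linearZ_LR.
  rewrite big_split linearD addrACA -/(golod_d (golod_d U) [::]) golod_dd addr0.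
  by rewrite addrC.
have au0 := h_indep dg.
have {}dg : d g = 0.
  by move: dg; rewrite big1 ?add0r // => l _; rewrite au0 rmorph0 scale0r.
have [b [a [u gE]]] := h_span dg.
(* an element whose boundary is that cycle, up to a constant *)
pose V (w : seq L) : K :=
  if w is l :: v then if v is [::] then iota (b l) *: one else 0 else u.
exists a, (fun w => U w + V w) => w; rewrite golod_dD.
case/lastP: w => [|w l].
  rewrite -(subrK (golod_d U [::]) (f [::])) -/g gE /=.
  have -> : golod_d V [::] = d u + \sum_l iota (b l) *: h l one.
    by congr (_ + _); apply: eq_bigr => l _; rewrite linearZ_LR.
  by rewrite !addrA [LHS](ACl (2*4*5*3*1)).
suff -> : golod_d V (rcons w l) = 0.
  by rewrite fU au0 rmorph0 scale0r !addr0; case: (w) => [|x v]; rewrite /= !add0r.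
rewrite /golod_d big1 => [|l' _]; last by case: (w) => *; rewrite /= linear0.
by case: (w) => [|x [|x' v]] /=; rewrite ?linear0 ?linearZ_LR /= ?d_one ?scaler0 addr0.
Qed.

End GolodComplex.

(** * Monomial ideals and sunflowers *)

Section MonomialIdeals.
Variables (k : fieldType) (N n : nat) (M : 'I_n -> 'X_{1..N}).
Local Notation A := {mpoly k[N]}.
Implicit Types (s : seq 'I_n) (a p q : A).
Let y i : A := 'X_[M i].

Lemma in_monomial_ideal s a : uniq s ->
  in_ideal y s a <-> {in msupp a, forall m, has (fun j => M j <= m)%MM s}.
Proof.
move=> us; split=> [[c ->] m|sa].
  move/msupp_sum_le/flatten_mapP => [j]; rewrite mem_filter /= => js.
  rewrite (perm_mem (msuppMX _ _)) => /mapP[m' _ ->].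
  by apply/hasP; exists j => //; apply: lem_addr.
rewrite [a]mpolyE big_seq; elim/big_ind: _ => [||m /sa/hasP[j js le_jm]].
- exact: in_ideal0.
- exact: in_idealD.
by rewrite -(submK le_jm) mpolyXD -mul_mpolyC mulrA; apply: in_ideal_gen.
Qed.

(** Multiplication by a monomial shifts supports, and M j divides M i + m only if it
divides m, because M i and M j have no variable in common. *)
Lemma monomial_regular :
  (forall i j x, i != j -> M i x = 0%N \/ M j x = 0%N) -> regular_family y.
Proof.
move=> disjM s i a /= /andP[is_ us]; rewrite !in_monomial_ideal // mulrC => sya.
move=> m ma; have /hasP[] : has (fun j => M j <= M i + m)%MM s.
  by apply: sya; rewrite (perm_mem (msuppMX _ _)) map_f.
move=> j js /mnm_lepP le_j; apply/hasP; exists j => //; apply/mnm_lepP => x.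
have ne_ij : i != j by apply: contraTneq js => <-.
by have := le_j x; rewrite mnmDE; case: (disjM i j x ne_ij) => -> //; rewrite add0n.
Qed.

End MonomialIdeals.

Section EdgeMonomials.
Variables (k : fieldType) (N : nat).
Local Notation A := {mpoly k[N]}.

Implicit Types Y Z : {set 'I_N}.

Definition set_mnm Y : 'X_{1..N} := [multinom (x \in Y : nat) | x < N].

Lemma edge_monomialE Y : edge_monomial k Y = 'X_[set_mnm Y].
Proof.
rewrite mpolyXE_id /edge_monomial [in LHS]big_mkcond /=.
by apply: eq_bigr => x _; rewrite mnmE; case: (x \in Y).
Qed.

Lemma edge_monomial_neq0 Y : edge_monomial k Y != 0.
Proof. by rewrite edge_monomialE -msupp_eq0 msuppX. Qed.

Lemma edge_monomialU Y Z : [disjoint Y & Z] ->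
  edge_monomial k (Y :|: Z) = edge_monomial k Y * edge_monomial k Z.
Proof. by move=> dYZ; rewrite /edge_monomial -bigU //=; apply: eq_bigl => x; rewrite !inE. Qed.

Lemma edge_monomialD1 x Y : x \in Y ->
  edge_monomial k Y = edge_monomial k (Y :\ x) * 'X_x.
Proof.
by move=> xY; rewrite /edge_monomial (big_setD1 x) //= mulrC.
Qed.

Lemma edge_monomial_aug Y : Y != set0 -> poly_aug k N (edge_monomial k Y) = 0.
Proof.
case/set0Pn=> x xY; rewrite (edge_monomialD1 xY) rmorphM /=.
by rewrite mevalXU mulr0.
Qed.

Lemma edge_monomial_regular n (Y : 'I_n -> {set 'I_N}) :
  (forall i j, i != j -> [disjoint Y i & Y j]) ->
  regular_family (fun i => edge_monomial k (Y i)).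
Proof.
move=> disjY; have := @monomial_regular k N n (fun i => set_mnm (Y i)).
have -> : (fun i => edge_monomial k (Y i)) = (fun i => 'X_[set_mnm (Y i)]).
  by apply: boolp.funext => i; rewrite edge_monomialE.
apply=> i j x /disjY dij; rewrite !mnmE.
by case: (boolP (x \in Y i)) => [xi|]; [right; rewrite (disjointFr dij xi) | left].
Qed.

Lemma variables_regular : regular_family (fun x : 'I_N => 'X_x : A).
Proof.
apply: monomial_regular => i j x ne_ij; rewrite !mnm1E.
by have [eix|] := eqVneq i x; [right; case: eqP => // ejx; rewrite eix ejx eqxx in ne_ij | left].
Qed.

Lemma sub_const_in_ideal (a : A) :
  in_ideal (fun x : 'I_N => 'X_x) (enum 'I_N) (a - (a@_0)%:MP).
Proof.
apply/(in_monomial_ideal (fun x => U_(x)%MM)); first exact: enum_uniq.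
move=> m; rewrite mcoeff_msupp mcoeffB mcoeffC => am.
have : m != 0%MM.
  by apply: contraNneq am => ->; rewrite eqxx mulr1 subrr.
move=> m0; apply/hasP.
have [x xm] : exists x, m x != 0%N.
  apply/existsP; rewrite -[X in is_true X]negbK negb_exists; apply: contraNN m0.
  by move/forallP=> m0; apply/eqP/mnmP=> x; rewrite mnm0E; apply/eqP; rewrite -[_ == _]negbK m0.
by exists x; rewrite ?mem_enum // lep1mP.
Qed.

End EdgeMonomials.

(** C is the core and the Y i are the petals. *)
Definition sunflower (N n : nat) (C : {set 'I_N}) (Y : 'I_n -> {set 'I_N})
    (E : {set {set 'I_N}}) : Prop :=
  [/\ C != set0, forall i, Y i != set0,
      forall i j, i != j -> [disjoint Y i & Y j],
      forall i, [disjoint C & Y i] &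
      E = [set C :|: Y i | i : 'I_n]].

(** For n > 1 the core is the intersection of the edges. For n = 1 that intersection
is the whole edge, which would leave an empty petal; a single vertex serves as the
core instead. *)
Lemma hyperstar_sunflower (n d a N : nat) (H : hypergraph N) :
  (1 <= n)%N -> (0 < a)%N -> (a < d)%N -> is_hyperstar n d a H ->
  exists (C : {set 'I_N}) (Y : 'I_n -> {set 'I_N}), sunflower C Y (edges H).
Proof.
move=> n_gt0 a_gt0 lt_ad [_ cardE cardD _ cardI].
pose ev (i : 'I_n) := enum_val (cast_ord (esym cardE) i).
have evE i : ev i \in edges H by apply: enum_valP.
have ev_inj : injective ev by move=> i j /enum_val_inj/cast_ord_inj.
have evS : edges H = [set ev i | i : 'I_n].
  apply/setP=> e; apply/idP/imsetP=> [eE|[i _ -> //]].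
  exists (cast_ord cardE (enum_rank_in eE e)) => //.
  by rewrite /ev cast_ordK enum_rankK_in.
suff [C [C0 CE CI]] : exists C : {set 'I_N}, [/\ C != set0,
    forall i, C \proper ev i & forall i j, i != j -> ev i :&: ev j = C].
  exists C, (fun i => ev i :\: C); split=> //.
  - by move=> i; rewrite -subset0 subDset setU0 proper_subn.
  - move=> i j /CI eC; rewrite -setI_eq0 -setDIl eC.
    by rewrite setDv.
  - by move=> i; rewrite disjoint_sym disjoints_subset subDset setUCr subsetT.
  rewrite evS; apply: eq_imset => i; rewrite setUC -{1}(setID (ev i) C) setUC.
  by rewrite (setIidPr (proper_sub (CE i))).
case: (leqP n 1) => n1.
  have i0 : 'I_n := Ordinal n_gt0.
  have all0 i j : i = j :> 'I_n.
    have val0 (l : 'I_n) : val l = 0%N.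
      by apply/eqP; rewrite -leqn0 -ltnS (leq_trans (ltn_ord l)).
    by apply: val_inj; rewrite !val0.
  have [x xe] : exists x, x \in ev i0.
    by apply/set0Pn; rewrite -card_gt0 cardD // (leq_ltn_trans _ lt_ad).
  exists [set x]; split=> [|i|i j]; last by rewrite (all0 i j) eqxx.
    by apply/set0Pn; exists x; rewrite set11.
  rewrite (all0 i i0) properEcard sub1set xe cards1 cardD //.
  exact: leq_ltn_trans lt_ad.
pose i0 : 'I_n := Ordinal n_gt0; pose i1 : 'I_n := Ordinal n1.
set C := \bigcap_(g in edges H) g.
have ev_ne i j : i != j -> ev i != ev j by rewrite (inj_eq ev_inj).
have [_ cardC] := cardI _ _ (evE i0) (evE i1) (ev_ne i0 i1 isT).
have CE i : C \subset ev i by apply: bigcap_inf.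
exists C; split=> [|i|i j ne_ij].
- by rewrite -card_gt0 cardC.
- by rewrite properEcard CE cardC cardD.
apply/esym/eqP; rewrite eqEcard subsetI !CE cardC.
have [eqI _] := cardI _ _ (evE i) (evE j) (ev_ne i j ne_ij).
by rewrite eqI -/C cardC leqnn.
Qed.

(** * Betti numbers *)

Section IdealMultiple.
Variables (k : fieldType) (A R : comNzRingType) (n : nat) (m : A) (y : 'I_n -> A).
Variables (phi : {rmorphism A -> R}) (eps : {rmorphism A -> k}).
Hypothesis y_regular : regular_family y.
Hypothesis m_inj : forall a, m * a = 0 -> a = 0.
Hypothesis phi_surj : forall r, exists a, phi a = r.
Hypothesis phi_ker : forall a, phi a = 0 <->
  exists q, in_ideal y (enum 'I_n) q /\ a = m * q.
Hypothesis eps_y : forall i, eps (y i) = 0.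

(** The Koszul differential of y, except that m multiplies the map into degree 0. *)
Definition multiple_d (f : {set 'I_n} -> A) (T : {set 'I_n}) : A :=
  (if T == set0 then m else 1) * kosz_d y (enum 'I_n) (finfun f) T.

Lemma tor_dim_multiple i : tor_dim eps (restrict phi) i = 'C(n, i).
Proof.
pose bas p := enum [set T : {set 'I_n} | #|T| == p].
have <- : size (bas i) = 'C(n, i).
  by rewrite -cardE card_draws card_ord.
apply: (@tor_dim_basis _ _ _ _ set0 (fun T : {set 'I_n} => #|T|) _ multiple_d).
- by move=> p; apply: enum_uniq.
- by move=> p T; rewrite mem_enum inE.
- apply: perm_small_eq => //; apply: uniq_perm => // [|T]; first exact: enum_uniq.
  by rewrite mem_enum !inE cards_eq0.
- move=> f g T fg; rewrite /multiple_d.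
  by rewrite (@kosz_d_local _ _ _ _ _ (finfun g) T) // => T' /fg; rewrite !ffunE.
- move=> a f g T; rewrite /multiple_d.
  have -> : finfun (fun T' => a * f T' + g T') =
      a *: (finfun f : {ffun {set 'I_n} -> A^o}) + finfun g.
    by apply/ffunP => T'; rewrite !ffunE.
  by rewrite linearP !ffunE mulrDr mulrCA.
- move=> f T; rewrite /multiple_d (@kosz_d_local _ _ _ _ _ (kosz_d y (enum 'I_n) (finfun f)) T).
    by rewrite kosz_dd ffunE mulr0.
  move=> T' T'1; rewrite ffunE -cards_eq0 T'1 mul1r.
  by congr (_ _ T').
- move=> p f f_hom df.
  have [||a [u fE]] := @koszul_exact _ _ y (finfun f).
  - exact: y_regular.
  - apply/ffunP=> T; rewrite [RHS]ffunE; have := df T; rewrite /multiple_d.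
    by case: ifP => _; [apply: m_inj | rewrite mul1r].
  exists u => T T1; have T0 : T != set0 by rewrite -cards_eq0 T1.
  have /ffunP/(_ T) := fE; rewrite !ffunE (negPf T0) scaler0 add0r => ->.
  rewrite /multiple_d (negPf T0) mul1r; congr (kosz_d _ _ _ T).
  by apply/ffunP => T'; rewrite ffunE.
- exact: phi_surj.
- move=> s; rewrite phi_ker; split=> [[q [qJ ->]]|[u ->]].
    have [u uE] := in_ideal_boundary (enum_uniq _) qJ; exists u.
    rewrite /multiple_d eqxx; congr (_ * _).
    have /ffunP/(_ set0) := uE; rewrite !ffunE eqxx [_ *: _]mulr1 => ->.
    by congr (kosz_d _ _ _ set0); apply/ffunP => T'; rewrite ffunE.
  exists (kosz_d y (enum 'I_n) (finfun u) set0); rewrite /multiple_d eqxx.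
  by split=> //; apply: in_ideal_d.
- move=> f T; rewrite rmorphM; have [c ->] := in_ideal_d y (enum 'I_n) (finfun f) T.
  by rewrite rmorph_sum big1 ?mulr0 // => i' _; rewrite rmorphM eps_y mulr0.
Qed.

End IdealMultiple.

Section SunflowerIdeal.
Variables (k : fieldType) (N n : nat) (H : hypergraph N).
Variables (C : {set 'I_N}) (Y : 'I_n -> {set 'I_N}).
Hypothesis sunH : sunflower C Y (edges H).
Local Notation A := {mpoly k[N]}.
Local Notation m := (edge_monomial k C).
Local Notation y := (fun i => edge_monomial k (Y i)).

Lemma halg_pi_eq0 (p : A) : halg_pi k H p = 0 <-> p \in edge_ideal H.
Proof.
rewrite -{2}[p]subr0 (Quotient.idealrBE (edge_idealr k H)) -/(halg_pi k H _).
rewrite -[\pi_(_) 0]/(halg_pi k H 0) rmorph0.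
by split=> [->|/eqP].
Qed.

Lemma halg_pi_surj r : exists p : A, halg_pi k H p = r.
Proof. by exists (repr r); apply: reprK. Qed.

Lemma petal_union_inj : injective (fun i => C :|: Y i).
Proof.
case: sunH => _ Y0 disjY disjC _ i j eqU; apply/eqP; apply: contraT => ne_ij.
have /set0Pn[x xi] := Y0 i; have := disjY _ _ ne_ij.
move/disjointFr/(_ xi) => xj.
have : x \in C :|: Y j by rewrite -eqU inE xi orbT.
by rewrite inE xj orbF (disjointFl (disjC i) xi).
Qed.

Lemma edge_ideal_sunflower (p : A) : p \in edge_ideal H <->
  exists q, in_ideal y (enum 'I_n) q /\ p = m * q.
Proof.
have [_ _ _ disjC edgesE] := sunH.
have sumE (c : {set 'I_N} -> A) :
    \sum_(e in edges H) c e * edge_monomial k e =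
    m * \sum_(i <- enum 'I_n) c (C :|: Y i) * edge_monomial k (Y i).
  rewrite edgesE big_imset /= => [|i j _ _]; last exact: petal_union_inj.
  rewrite big_enum mulr_sumr; apply: eq_bigr => i _.
  by rewrite edge_monomialU // mulrCA.
split=> [/edge_idealP[c ->]|[q [[c ->] ->]]].
  by rewrite sumE; eexists; split; last reflexivity; exists (fun i => c (C :|: Y i)).
apply/edge_idealP.
exists (fun e => if [pick i | C :|: Y i == e] is Some i then c i else 0).
rewrite sumE; congr (_ * _); apply: eq_bigr => i _; congr (_ * _).
case: pickP => [j /eqP/petal_union_inj -> //|/(_ i)].
by rewrite eqxx.
Qed.

Lemma halg_pi_sunflower (p : A) : halg_pi k H p = 0 <->
  exists q, in_ideal y (enum 'I_n) q /\ p = m * q.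
Proof. by rewrite halg_pi_eq0; apply: edge_ideal_sunflower. Qed.

Lemma petals_regular : regular_family y.
Proof. by case: sunH => _ _ disjY _ _; apply: edge_monomial_regular. Qed.

Lemma core_regular (a : A) : m * a = 0 -> a = 0.
Proof. by move/eqP; rewrite mulf_eq0 (negPf (edge_monomial_neq0 k C)) => /eqP. Qed.

Lemma betti_sunflower i : betti k H i = 'C(n, i).
Proof.
apply: (tor_dim_multiple petals_regular core_regular).
- exact: halg_pi_surj.
- exact: halg_pi_sunflower.
- by case: sunH => _ Y0 _ _ _ j; apply: edge_monomial_aug.
Qed.

End SunflowerIdeal.

(** * Right multiplications in a Koszul complex *)

Section RightWedge.
Variables (S : comNzRingType) (N : nat).
Local Notation K := {ffun {set 'I_N} -> S^o}.
Implicit Types (a b : S) (f g : K) (i j : 'I_N).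

(** Right multiplication by a e_j: moving e_j to the left of f introduces the degree
involution. *)
Definition rwedge a j f : K := a *: wedge j (kosz_parity f).

Lemma rwedge_linear a j : linear (rwedge a j).
Proof.
move=> b f g; rewrite /rwedge (linearP (@kosz_parity S N)) (linearP (wedge j)) /=.
by rewrite scalerDr !scalerA mulrC.
Qed.

HB.instance Definition _ a j :=
  GRing.isLinear.Build S K K _ (rwedge a j) (rwedge_linear a j).

Lemma d_rwedge (x : 'I_N -> S) s a j f : uniq s -> j \in s ->
  kosz_d x s (rwedge a j f) =
  (a * x j) *: kosz_parity f + rwedge a j (kosz_d x s f).
Proof.
move=> us js; rewrite /rwedge (linearZ_LR (kosz_d x s)) /= kosz_d_wedge // js.
rewrite mul1r scalerBr scalerA; congr (_ + _).
by rewrite parity_d linearN scalerN.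
Qed.

Lemma rwedge_rwedge a b j f : rwedge a j (rwedge b j f) = 0.
Proof.
rewrite /rwedge (linearZ_LR (@kosz_parity S N)) (linearZ_LR (wedge j)) /=.
by rewrite parity_wedge linearN /= wedge_wedge oppr0 !scaler0.
Qed.

Lemma rwedgeC a b i j f :
  rwedge a i (rwedge b j f) = - rwedge b j (rwedge a i f).
Proof.
rewrite /rwedge !(linearZ_LR (@kosz_parity S N)) !(linearZ_LR (wedge _)) /=.
rewrite !parity_wedge !linearN /= wedgeC !scalerN opprK !scalerA mulrC.
by rewrite opprK.
Qed.

Lemma parity_rwedge a j f :
  kosz_parity (rwedge a j f) = - rwedge a j (kosz_parity f).
Proof.
by rewrite /rwedge (linearZ_LR (@kosz_parity S N)) /= parity_wedge scalerN.
Qed.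

Lemma kosz_parity1 : kosz_parity (kosz1 S N) = kosz1 S N.
Proof.
apply/ffunP=> T; rewrite !ffunE; case: eqP => [->|_]; last by rewrite mulr0.
by rewrite /degree_sign cards0 mul1r.
Qed.

End RightWedge.

Section BaseChange.
Variables (S S' : comNzRingType) (phi : {rmorphism S -> S'}) (N : nat).
Local Notation K := {ffun {set 'I_N} -> S^o}.
Local Notation K' := {ffun {set 'I_N} -> S'^o}.
Implicit Types (a : S) (f g : K) (j : 'I_N).

Definition base_change f : K' := [ffun T => phi (f T)].

Lemma base_change_zmod : zmod_morphism base_change.
Proof. by move=> f g; apply/ffunP=> T; rewrite !ffunE rmorphB. Qed.

HB.instance Definition _ := GRing.isZmodMorphism.Build K K' base_change
  base_change_zmod.

Lemma base_changeZ a f : base_change (a *: f) = phi a *: base_change f.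
Proof. by apply/ffunP=> T; rewrite !ffunE rmorphM. Qed.

Lemma base_change_contract j f :
  base_change (contract j f) = contract j (base_change f).
Proof.
apply/ffunP=> T; rewrite !ffunE; case: ifP => _; first exact: rmorph0.
by rewrite rmorphM rmorph_sign.
Qed.

Lemma base_change_wedge j f : base_change (wedge j f) = wedge j (base_change f).
Proof.
apply/ffunP=> T; rewrite !ffunE; case: ifP => _; last exact: rmorph0.
by rewrite rmorphM rmorph_sign.
Qed.

Lemma base_change_parity f :
  base_change (kosz_parity f) = kosz_parity (base_change f).
Proof. by apply/ffunP=> T; rewrite !ffunE rmorphM rmorph_sign. Qed.

Lemma base_change_d x s f :
  base_change (kosz_d x s f) = kosz_d (phi \o x) s (base_change f).
Proof.
rewrite raddf_sum; apply: eq_bigr => j _ /=.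
by rewrite base_changeZ base_change_contract.
Qed.

Lemma base_change_rwedge a j f :
  base_change (rwedge a j f) = rwedge (phi a) j (base_change f).
Proof. by rewrite base_changeZ base_change_wedge base_change_parity. Qed.

Lemma base_change1 : base_change (kosz1 S N) = kosz1 S' N.
Proof. by apply/ffunP=> T; rewrite !ffunE; case: eqP; rewrite ?rmorph1 ?rmorph0. Qed.

Lemma base_change_surj : (forall r, exists a, phi a = r) ->
  forall g : K', exists f, base_change f = g.
Proof.
move=> /boolp.choice[psi psiK] g; exists [ffun T => psi (g T)].
by apply/ffunP=> T; rewrite !ffunE psiK.
Qed.

Section GolodOp.
Variables (I : finType) (d : {linear K -> K}) (d' : {linear K' -> K'}).
Variables (e : I -> {linear K -> K}) (e' : I -> {linear K' -> K'}).
Variables (mu : S) (ez : {linear K -> K}) (ez' : {linear K' -> K'}).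
Hypothesis base_d : forall f, base_change (d f) = d' (base_change f).
Hypothesis base_e : forall i f, base_change (e i f) = e' i (base_change f).
Hypothesis base_ez : forall f, base_change (ez f) = ez' (base_change f).

Lemma base_change_rmul s (T : {set I}) f :
  base_change (rmul e s T f) = rmul e' s T (base_change f).
Proof. by elim: s => //= i s IHs; case: ifP; rewrite ?base_e IHs. Qed.

Lemma base_change_golod_op (T : {set I}) f :
  base_change (golod_op d e mu ez T f) =
  golod_op d' e' (phi mu) ez' T (base_change f).
Proof.
rewrite [LHS]base_changeZ rmorphN /rmul_d raddfB /= base_d !base_change_rmul.
by rewrite base_d base_ez.
Qed.

End GolodOp.

End BaseChange.

(** * The basis of the resolution of the residue field *)

Section WordBasis.
Variables (L : finType) (wt : L -> nat) (N : nat).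
Local Notation B := (seq L * {set 'I_N})%type.

Definition word_degree (b : B) : nat := (sumn [seq (wt l).+1 | l <- b.1] + #|b.2|)%N.

(** Every letter has positive degree, so any [fuel] above p lists all of degree p. *)
Fixpoint words_upto (fuel p : nat) : seq B :=
  if fuel is fuel'.+1 then
    [seq ([::], T) | T <- enum [set T : {set 'I_N} | #|T| == p]] ++
    [seq (l :: b.1, b.2) | l <- enum L,
       b <- if (wt l < p)%N then words_upto fuel' (p - (wt l).+1) else [::]]
  else [::].

Definition words p := words_upto p.+1 p.

Lemma mem_words_upto fuel p b : (p < fuel)%N ->
  (b \in words_upto fuel p) = (word_degree b == p).
Proof.
elim: fuel p b => // fuel IHf p [w T] lt_pf; rewrite mem_cat.
case: w => [|l w].
  rewrite orbC (_ : _ \in _ = false) /=; last first.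
    by apply/negP => /allpairsPdep[l [b [_ _]]].
  by rewrite mem_map => [|U V []//]; rewrite mem_enum inE.
rewrite (_ : _ \in _ = false) /=; last by apply/negP => /mapP[].
rewrite /word_degree /= -addnA -/(word_degree (w, T)).
have wP : (wt l < p)%N ->
  ((w, T) \in words_upto fuel (p - (wt l).+1)) = (word_degree (w, T) == p - (wt l).+1)%N.
  move=> lt_lp; rewrite IHf //; apply: leq_trans (lt_pf : (p <= fuel)%N).
  by rewrite ltn_subrL (leq_ltn_trans _ lt_lp).
apply/allpairsPdep/eqP.
  case=> [l' [[w' T'] [_ + [el ew eT]]]]; rewrite -{}el -{}ew -{}eT.
  by case: ifP => // lt_lp; rewrite wP // => /eqP ->; rewrite subnKC.
move=> degE; exists l, (w, T); split; rewrite ?mem_enum //.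
have lt_lp : (wt l < p)%N by rewrite -degE addSn ltnS leq_addr.
by rewrite lt_lp wP // -degE addKn.
Qed.

Lemma uniq_words_upto fuel p : uniq (words_upto fuel p).
Proof.
elim: fuel p => //= fuel IHf p; rewrite cat_uniq map_inj_uniq => [|U V []//].
rewrite enum_uniq /=; apply/andP; split.
  by apply/hasPn => _ /allpairsPdep[l [b [_ _ ->]]]; apply/negP => /mapP[].
apply: allpairs_uniq_dep => [|l _|]; first exact: enum_uniq.
  by case: ifP.
by move=> [l b] [l' b'] _ _ /= [-> eb1 eb2]; congr existT; case: b b' eb1 eb2 => ? ? [? ?] /= -> ->.
Qed.

Lemma size_words_upto fuel p : (p < fuel)%N -> size (words_upto fuel p) = size (words p).
Proof.
move=> lt_pf; apply/perm_size/uniq_perm; rewrite ?uniq_words_upto // => b.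
by rewrite !mem_words_upto.
Qed.

(** Either the word is empty or its first letter can be split off. *)
Lemma size_words p : size (words p) =
  ('C(N, p) + \sum_(l : L | (wt l < p)%N) size (words (p - (wt l).+1)))%N.
Proof.
rewrite /words [words_upto _ _]/= size_cat size_map -cardE card_draws card_ord.
congr addn; rewrite size_allpairs_dep sumnE big_map big_enum [RHS]big_mkcond /=.
apply: eq_bigr => l _; case: ifP => // lt_lp; apply: size_words_upto.
by rewrite ltn_subrL (leq_ltn_trans _ lt_lp).
Qed.

Lemma words0 : words 0 = [:: ([::], set0)].
Proof.
apply: perm_small_eq => //; apply: uniq_perm => // [|[w T]].
  exact: uniq_words_upto.
rewrite mem_words_upto // inE /word_degree /= addn_eq0 cards_eq0.
by case: w => [|l w]; rewrite xpair_eqE //= andbF.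
Qed.

End WordBasis.

(** * The resolution of the residue field *)

Lemma ffun_linE (S : comNzRingType) (I : finType) a
    (f g : {ffun I -> S^o}) i : (a *: f + g) i = a * f i + g i.
Proof. by rewrite !ffunE. Qed.

Section DegreeShift.
Variables (S : comNzRingType) (N : nat).
Local Notation K := {ffun {set 'I_N} -> S^o}.
Implicit Types (f g : K) (op : K -> K).

(** [op] raises exterior degrees by a - b; keeping both a and b avoids negative
numbers. *)
Definition shifts a b op := forall f g (T : {set 'I_N}),
  (forall T' : {set 'I_N}, (#|T'| + a = #|T| + b)%N -> f T' = g T') -> op f T = op g T.

Lemma shifts_comp a b a' b' op op' : shifts a b op -> shifts a' b' op' ->
  shifts (a + a') (b + b') (op \o op').
Proof.
move=> sop sop' f g T fg; apply: sop => T' eT'; apply: sop' => T'' eT''.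
by apply: fg; rewrite (addnC a) addnA eT'' addnAC eT' -addnA.
Qed.

Lemma shifts_d (x : 'I_N -> S) s : shifts 0 1 (kosz_d x s).
Proof.
move=> f g T fg; apply: kosz_d_local => T' eT'; apply: fg.
by rewrite addn0 addn1.
Qed.

Lemma shifts_rwedge (a : S) j : shifts 1 0 (rwedge a j).
Proof.
move=> f g T fg; rewrite !ffunE; case: ifP => // jT; rewrite fg //.
by rewrite addn0 [RHS](cardsD1 j) jT addnC.
Qed.

Variables (I : finType) (d ez : {linear K -> K}) (e : I -> {linear K -> K}).
Hypotheses (d_shifts : shifts 0 1 d) (ez_shifts : shifts 1 0 ez).
Hypothesis e_shifts : forall i, shifts 1 0 (e i).

Lemma shifts_rmul s (T : {set I}) : shifts (count (mem T) s) 0 (rmul e s T).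
Proof.
elim: s => [|i s IHs] f g U /=; first by apply; rewrite !addn0.
case: (boolP (i \in T)) => iT fg; last exact: IHs.
exact: (shifts_comp (e_shifts i) IHs).
Qed.

Lemma shifts_golod_op mu (T : {set I}) : shifts #|T|.+1 1 (golod_op d e mu ez T).
Proof.
have cT : count (mem T) (enum I) = #|T|.
  by rewrite -size_filter cardE {2}/enum_mem enumT.
have sT := @shifts_rmul (enum I) T; rewrite cT in sT.
have s1 := shifts_comp d_shifts (shifts_comp sT ez_shifts).
have s2 := shifts_comp sT (shifts_comp d_shifts ez_shifts).
move=> f g U fg; rewrite /golod_op /rmul_d !ffunE; congr (_ *: (_ - _)).
  by apply: s1 => T'; rewrite !add0n addn1 => /fg.
by apply: s2 => T'; rewrite !add0n addn1 => /fg.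
Qed.

End DegreeShift.

(** The model is A = k[V] with variables x, the inclusion [iota] of the scalars, the
projection [phi] to R = A / mJ and the residue map [eps] of R. The equation
[y i = c i * x (v i)] says that c_i e_(v_i) has differential y_i. *)
Section GolodResolution.
Variables (k : fieldType) (A R : comNzRingType) (iota : {rmorphism k -> A}).
Variables (phi : {rmorphism A -> R}) (eps : {rmorphism R -> k}).
Variables (N n : nat) (x : 'I_N -> A) (y : 'I_n -> A).
Variables (m mu : A) (z : 'I_N) (c : 'I_n -> A) (v : 'I_n -> 'I_N).
Hypothesis x_regular : regular_family x.
Hypothesis y_regular : regular_family y.
Hypothesis m_inj : forall a, m * a = 0 -> a = 0.
Hypothesis m_mu : m = mu * x z.
Hypothesis y_c : forall i, y i = c i * x (v i).
Hypothesis phi_surj : forall r, exists a, phi a = r.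
Hypothesis phi_ker : forall a, phi a = 0 <->
  exists q, in_ideal y (enum 'I_n) q /\ a = m * q.
Hypothesis eps_x : forall j, eps (phi (x j)) = 0.
Hypothesis eps_iota : forall b, eps (phi (iota b)) = b.
Hypothesis iota_split : forall a, exists b, in_ideal x (enum 'I_N) (a - iota b).

Local Notation K := {ffun {set 'I_N} -> A^o}.
Local Notation KR := {ffun {set 'I_N} -> R^o}.
Local Notation d := (kosz_d x (enum 'I_N)).
Local Notation dR := (kosz_d (phi \o x) (enum 'I_N)).
Local Notation theta := (@kosz_parity A N).
Local Notation thetaR := (@kosz_parity R N).
Local Notation one := (kosz1 A N).
Local Notation oneR := (kosz1 R N).
Local Notation kappa := (@base_change A R phi N).

Definition petal_mul i : {linear K -> K} := rwedge (c i) (v i).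
Definition petal_mulR i : {linear KR -> KR} := rwedge (phi (c i)) (v i).
Definition core_mul : {linear K -> K} := rwedge 1 z.
Definition core_mulR : {linear KR -> KR} := rwedge 1 z.

Local Notation cyc := (golod_op d petal_mul mu core_mul).
Local Notation cycR := (golod_op dR petal_mulR (phi mu) core_mulR).

Lemma in_spanP s (f : K) : in_span y s f <-> forall T, in_ideal y s (f T).
Proof.
split=> [[b ->] T|/boolp.choice[b fE]].
  exists (fun j => b j T); rewrite sum_ffunE.
  by apply: eq_bigr => j _; rewrite ffunE; apply: mulrC.
exists (fun j => [ffun T => b T j]); apply/ffunP=> T.
by rewrite fE sum_ffunE; apply: eq_bigr => j _; rewrite !ffunE; apply: mulrC.
Qed.

Lemma d_petal i f : d (petal_mul i f) = y i *: theta f + petal_mul i (d f).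
Proof. by rewrite y_c; apply: d_rwedge; rewrite ?enum_uniq ?mem_enum. Qed.

Lemma d_core f : d (core_mul f) = x z *: theta f + core_mul (d f).
Proof. by rewrite -[x z]mul1r; apply: d_rwedge; rewrite ?enum_uniq ?mem_enum. Qed.

Lemma variables_exact f : d f = 0 -> exists b u, f = iota b *: one + d u.
Proof.
move=> /(koszul_exact x_regular)[a [u ->]]; have [b abx] := iota_split a.
have [u' u'E] := in_ideal_boundary (enum_uniq _) abx.
by exists b, (u' + u); rewrite (linearD (kosz_d x _)) /= -u'E scalerBl addrA [_ + (_ - _)]addrC subrK.
Qed.

Lemma eps_d (f : KR) T : eps (dR f T) = 0.
Proof.
have [b ->] := in_ideal_d (phi \o x) (enum 'I_N) f T.
by rewrite rmorph_sum big1 // => j _; rewrite rmorphM eps_x mulr0.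
Qed.

Lemma constant_indep s b u : in_span y s (iota b *: one + d u) -> b = 0.
Proof.
move/in_spanP/(_ set0) => [a]; move/(congr1 (eps \o phi)).
rewrite !ffunE eqxx [_ *: _]mulr1 /= !rmorphD eps_iota.
have -> : phi (d u set0) = dR (kappa u) set0.
  by rewrite -base_change_d ffunE.
rewrite eps_d addr0 => ->; rewrite !rmorph_sum big1 // => j _.
by rewrite y_c !rmorphM eps_x !mulr0.
Qed.

Lemma petals_span_regular s i (f : K) :
  uniq (i :: s) -> in_span y s (y i *: f) -> in_span y s f.
Proof.
move=> us /in_spanP yf; apply/in_spanP=> T; apply: (y_regular us).
by have := yf T; rewrite ffunE.
Qed.

Lemma m_inj_kosz (f : K) : m *: f = 0 -> f = 0.
Proof.
move/ffunP=> mf; apply/ffunP=> T; rewrite [RHS]ffunE; apply: m_inj.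
by have := mf T; rewrite !ffunE.
Qed.

Lemma base_change_eq0 (f : K) : kappa f = 0 <->
  exists j, in_span y (enum 'I_n) j /\ f = m *: j.
Proof.
split=> [/ffunP f0|[j [/in_spanP jy ->]]]; last first.
  apply/ffunP=> T; rewrite !ffunE; apply/phi_ker.
  by exists (j T).
have /boolp.choice[j jP] T : exists q, in_ideal y (enum 'I_n) q /\ f T = m * q.
  by apply/phi_ker; have := f0 T; rewrite !ffunE.
exists (finfun j); split.
  by apply/in_spanP=> T; rewrite ffunE; case: (jP T).
by apply/ffunP=> T; rewrite !ffunE; case: (jP T).
Qed.

Lemma base_change_cyc T f : kappa (cyc T f) = cycR T (kappa f).
Proof.
apply: base_change_golod_op => [g|i g|g]; first exact: base_change_d.
  exact: base_change_rwedge.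
by rewrite /core_mul /core_mulR base_change_rwedge rmorph1.
Qed.

Lemma d_petalR i f :
  dR (petal_mulR i f) = phi (y i) *: thetaR f + petal_mulR i (dR f).
Proof.
by rewrite y_c rmorphM; apply: d_rwedge; rewrite ?enum_uniq ?mem_enum.
Qed.

Lemma d_coreR f : dR (core_mulR f) = phi (x z) *: thetaR f + core_mulR (dR f).
Proof. by rewrite -[phi (x z)]mul1r; apply: d_rwedge; rewrite ?enum_uniq ?mem_enum. Qed.

(** m y_i is zero in R. *)
Lemma d_cycR T f : dR (cycR T f) = - cycR T (dR f).
Proof.
rewrite (d_golod_op (theta := thetaR) _ (kosz_dd _ _) _ d_coreR) -rmorphM -m_mu.
rewrite (rmul_d_annihilated d_petalR) ?sub0r // => i.
rewrite -rmorphM; apply/phi_ker; exists (y i); split=> //.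
by rewrite -[y i]mul1r; apply: in_ideal_gen; rewrite ?enum_uniq ?mem_enum.
Qed.

Lemma cycR_cycR T T' f : cycR T (cycR T' f) = 0.
Proof.
apply: (golod_op_op (theta := thetaR)) => [g|g|i g|i g|g].
- exact: d_coreR.
- exact: rwedge_rwedge.
- exact: rwedgeC.
- exact: parity_rwedge.
- exact: parity_rwedge.
Qed.

Definition letter := {T : {set 'I_n} | T \in predC1 set0}.

Lemma sum_letter (V : nmodType) (F : {set 'I_n} -> V) : F set0 = 0 ->
  \sum_T F T = \sum_(l : letter) F (val l).
Proof.
move=> F0; rewrite (bigD1 set0) //= F0 add0r.
by rewrite -(big_sub (predC1 set0) F); apply: eq_bigl.
Qed.

Definition letter_mul (l : letter) : {linear KR -> KR} := cycR (val l).

(** A cycle over R lifts to an element over A whose differential has coefficients in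
mJ. *)
Lemma letter_span (g : KR) : dR g = 0 -> exists (b : letter -> k) a u,
  g = \sum_l phi (iota (b l)) *: letter_mul l oneR + phi (iota a) *: oneR + dR u.
Proof.
have [f <-] := base_change_surj phi_surj g.
rewrite -base_change_d => /base_change_eq0[w [wy df]].
have [b [a [u [j [jy ->]]]]] := multiple_cycles (kosz_d_kosz1 _ _) (kosz_dd _ _)
  (@kosz_parityK _ _) (@parity_d _ _ _ _) d_petal variables_exact constant_indep
  petals_span_regular m_inj_kosz d_core m_mu (@kosz_parity1 _ _) wy df.
exists (fun l => b (val l)), a, (kappa u).
rewrite raddfD raddfD raddfD /= (proj2 (base_change_eq0 (m *: j))); last by exists j.
rewrite addr0 base_change_d base_changeZ base_change1; congr (_ + _ + _).
rewrite raddf_sum sum_letter /=; last by rewrite golod_op0 scaler0 raddf0.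
by apply: eq_bigr => l _; rewrite base_changeZ base_change_cyc base_change1.
Qed.

Lemma letter_indep (b : letter -> k) (u : KR) :
  \sum_l phi (iota (b l)) *: letter_mul l oneR + dR u = 0 -> forall l, b l = 0.
Proof.
have [f <-] := base_change_surj phi_surj u => sum0 l.
pose b' T := if insub T is Some l then b l else 0.
have : kappa (\sum_T iota (b' T) *: cyc T one + d f) = 0.
  rewrite -sum0 raddfD /= base_change_d; congr (_ + _).
  rewrite raddf_sum sum_letter /=; last by rewrite golod_op0 scaler0 raddf0.
  apply: eq_bigr => l' _; rewrite base_changeZ base_change_cyc base_change1.
  by rewrite /b' valK.
case/base_change_eq0=> j [jy eqj].
have := multiple_cycles_indep (kosz_d_kosz1 _ _) (kosz_dd _ _)
  (@kosz_parityK _ _) (@parity_d _ _ _ _) d_petal variables_exact constant_indep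
  petals_span_regular m_inj_kosz d_core m_mu (@kosz_parity1 _ _) jy eqj (valP l).
by rewrite /b' valK.
Qed.

Local Notation word_deg := (@word_degree _ (fun l : letter => #|val l|) N).
Local Notation B := (seq letter * {set 'I_N})%type.

Lemma golod_dE (f : seq letter -> KR) w T : golod_d dR letter_mul f w T =
  dR (f w) T + \sum_l cycR (val l) (f (l :: w)) T.
Proof. by rewrite [LHS]ffunE; congr (_ + _); apply: sum_ffunE. Qed.

Definition word_fun (F : B -> R) (w : seq letter) : KR := [ffun T => F (w, T)].

Definition word_d (F : B -> R) (b : B) : R :=
  golod_d dR letter_mul (word_fun F) b.1 b.2.

Lemma word_d_local F G b :
  (forall b', word_deg b' = (word_deg b).+1 -> F b' = G b') ->
  word_d F b = word_d G b.
Proof.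
case: b => w T FG; rewrite /word_d [LHS]golod_dE [RHS]golod_dE.
apply: (f_equal2 +%R).
  apply: (@shifts_d _ _ (phi \o x)) => T' eT'; rewrite !ffunE FG // /word_degree /=.
  by rewrite -[#|T'|]addn0 eT' addn1 addnS.
apply: eq_bigr => l _.
apply: shifts_golod_op => [|| i | T' eT']; rewrite /core_mulR /petal_mulR.
- exact: shifts_d.
- exact: shifts_rwedge.
- exact: shifts_rwedge.
rewrite !ffunE FG // /word_degree /= -addnS -[#|T|.+1]addn1 -eT'.
by rewrite -addnA addnC -addnA.
Qed.

Lemma word_d_linear a F G b :
  word_d (fun b' => a * F b' + G b') b = a * word_d F b + word_d G b.
Proof.
rewrite /word_d -ffun_linE; congr (fun_of_fin _ b.2).
have funE w : word_fun (fun b' => a * F b' + G b') w =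
    a *: word_fun F w + word_fun G w.
  by apply/ffunP=> T; rewrite [RHS]ffun_linE !ffunE.
rewrite /golod_d funE (linearP (kosz_d _ _)) scalerDr addrACA.
apply: (f_equal2 +%R) => //; rewrite scaler_sumr -big_split /=.
by apply: eq_bigr => l _; rewrite funE (linearP (cycR (val l))).
Qed.

Lemma word_fun_d F w : word_fun (word_d F) w = golod_d dR letter_mul (word_fun F) w.
Proof. by apply/ffunP=> T; rewrite ffunE. Qed.

Lemma word_d_square F b : word_d (word_d F) b = 0.
Proof.
rewrite /word_d /golod_d word_fun_d.
rewrite (eq_bigr (fun l => letter_mul l (golod_d dR letter_mul (word_fun F) (l :: b.1))))
  => [|l _]; last by rewrite word_fun_d.
rewrite -/(golod_d dR letter_mul (golod_d dR letter_mul (word_fun F)) b.1).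
rewrite golod_dd ?ffunE // => [g|l g|l l' g].
- exact: kosz_dd.
- exact: d_cycR.
- exact: cycR_cycR.
Qed.

Lemma word_d_exact p F : (forall b, (p < word_deg b)%N -> F b = 0) ->
  (forall b, word_d F b = 0) -> exists a G, forall b,
    F b = phi (iota a) * (b == ([::], set0))%:R + word_d G b.
Proof.
move=> F0 dF.
have [||a [u uE]] := golod_exact (iota := phi \o iota) (p := p.+1)
    (f := word_fun F) (kosz_dd _ _) (kosz_d_kosz1 _ _) (fun l => d_cycR (val l))
    (fun l l' => cycR_cycR (val l) (val l')) letter_span letter_indep.
- move=> w lt_pw; apply/ffunP=> T; rewrite !ffunE F0 // /word_degree /=.
  apply: leq_trans lt_pw (leq_trans _ (leq_addr _ _)).
  by elim: w => //= l w IHw; rewrite addSn ltnS (leq_trans IHw) // leq_addl.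
- by move=> w; apply/ffunP=> T; rewrite [RHS]ffunE -(dF (w, T)).
exists a, (fun b => u b.1 b.2) => -[w T].
have uU : word_fun (fun b => u b.1 b.2) = u.
  by apply: boolp.funext => w'; apply/ffunP=> T'; rewrite ffunE.
have /ffunP/(_ T) := uE w; rewrite [LHS]ffunE [RHS]ffunE /word_d uU => ->.
apply: (f_equal2 +%R); last exact: erefl.
by case: w => [|l w]; rewrite xpair_eqE /= ?ffunE // mulr0.
Qed.

(** Every term contains a differential of K, whose coefficients are combinations of
the variables. *)
Lemma word_d_minimal F b : eps (word_d F b) = 0.
Proof.
have eps_rmul s (T : {set 'I_n}) (f : KR) : (forall U, eps (f U) = 0) ->
    forall U, eps (rmul petal_mulR s T f U) = 0.
  move=> f0; elim: s => //= i s IHs U; case: ifP => // _.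
  rewrite !ffunE; case: ifP => _; last by rewrite scaler0 rmorph0.
  by rewrite !rmorphM IHs !mulr0.
rewrite /word_d golod_dE rmorphD eps_d add0r rmorph_sum big1 // => l _.
rewrite /letter_mul /= /golod_op /rmul_d !ffunE.
by rewrite rmorphM rmorphB eps_d eps_rmul ?subrr ?mulr0 // => U; apply: eps_d.
Qed.

Lemma tor_dim_golod i : tor_dim eps (restrict eps) i =
  size (words (fun l : letter => #|val l|) N i).
Proof.
apply: (@tor_dim_basis R k eps _ ([::], set0) word_deg
  (words (fun l : letter => #|val l|) N) word_d).
- by move=> p; apply: uniq_words_upto.
- by move=> p b; apply: mem_words_upto.
- exact: words0.
- exact: word_d_local.
- exact: word_d_linear.
- exact: word_d_square.
- move=> p F F0 dF; have [|a [G FE]] := @word_d_exact p.+1 F _ dF.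
    by move=> b; rewrite ltn_neqAle => /andP[/eqP nb _]; apply: F0 => e; apply: nb.
  exists G => b eb; rewrite FE (_ : (_ == _) = false) ?mulr0 ?add0r //.
  by apply: contra_eqF eb => /eqP ->; rewrite /word_degree /= cards0.
- by move=> a; exists (phi (iota a)); apply: eps_iota.
- move=> s; split=> [s0|[G ->]]; last exact: word_d_minimal.
  have [||a [G GE]] := @word_d_exact 0 (fun b => s * (b == ([::], set0))%:R).
  + by move=> b; case: eqP => [->|]; rewrite ?mulr0 // /word_degree /= cards0.
  + have funE w : word_fun (fun b => s * (b == ([::], set0))%:R) w =
        (if w is [::] then s else 0) *: oneR.
      apply/ffunP=> T; rewrite !ffunE xpair_eqE.
      by case: w => //= l w; rewrite mulr0 scale0r.
    move=> [w T]; rewrite /word_d /golod_d funE big1 => [|l _].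
      by rewrite addr0 (linearZ_LR (kosz_d _ _)) /= kosz_d_kosz1 scaler0 ffunE.
    by rewrite funE scale0r linear0.
  exists G; have := GE ([::], set0); rewrite eqxx !mulr1 => sE.
  have a0 : a = 0.
    by have := congr1 eps sE; rewrite rmorphD word_d_minimal s0 eps_iota addr0.
  by rewrite sE a0 !rmorph0 add0r.
- exact: word_d_minimal.
Qed.

End GolodResolution.

(** * The Poincare series *)

Lemma sum_nonempty_card (n : nat) (V : nmodType) (G : nat -> V) :
  \sum_(l : letter n) G #|val l| = \sum_(1 <= j < n.+1) G j *+ 'C(n, j).
Proof.
rewrite -(big_sub (predC1 set0) (fun T : {set 'I_n} => G #|T|)).
have card_lt (T : {set 'I_n}) : (#|T| < n.+1)%N.
  by rewrite ltnS -[X in (_ <= X)%N](card_ord n) max_card.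
rewrite (partition_big (fun T : {set 'I_n} => inord #|T| : 'I_n.+1)
  (fun j => 0 < j)%N) => [|T]; last by rewrite inE inordK // card_gt0.
rewrite [RHS]big_geq_mkord; apply: eq_bigr => j j_gt0.
have <- : #|[set T : {set 'I_n} | #|T| == j]| = 'C(n, j).
  by rewrite card_draws card_ord.
rewrite -sumr_const; apply: eq_big => T.
  rewrite !inE (_ : (inord #|T| == j) = (#|T| == j)) 1?andbC; last first.
    by rewrite -(inj_eq val_inj) /= inordK.
  by case: eqP => //= eTj; rewrite -card_gt0 eTj.
by case/andP=> _ /eqP <-; rewrite inordK.
Qed.

Lemma coef_1X_expn (N p : nat) : ((1 + 'X) ^+ N : {poly int})`_p = ('C(N, p))%:Z.
Proof.
elim: N p => [|N IHN] p; first by rewrite expr0 coef1 bin0n; case: p.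
rewrite exprS mulrDl mul1r coefD coefXM !IHN; case: p => [|p] /=.
  by rewrite !bin0 addr0.
by rewrite binS PoszD addrC.
Qed.

(** [size_words] is the assertion that the product with the denominator is
(1 + X)^N. *)
Lemma words_series (N n : nat) :
  (fun i => (size (words (fun l : letter n => #|val l|) N i))%:Z) =1
  poly_ratio ((1 + 'X) ^+ N) (1 - \sum_(1 <= i < n.+1) 'C(n, i)%:R *: 'X^(i.+1)).
Proof.
set r := fun i => _; pose s p : int := r p.
have sE p : s p = ('C(N, p))%:Z +
    \sum_(1 <= j < n.+1) (if (j < p)%N then s (p - j.+1)%N else 0) *+ 'C(n, j).
  rewrite -(@sum_nonempty_card n _ (fun j => if (j < p)%N then s (p - j.+1)%N else 0)).
  rewrite /s /r size_words PoszD; congr (_ + _).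
  by rewrite (big_morph Posz PoszD (erefl _)) big_mkcond.
have qE j : (1 - \sum_(1 <= i < n.+1) 'C(n, i)%:R *: 'X^(i.+1) : {poly int})`_j =
    (j == 0%N)%:R - \sum_(1 <= i < n.+1) 'C(n, i)%:R * (j == i.+1)%:R.
  rewrite coefB coef1 coef_sum; congr (_ - _); apply: eq_bigr => i _.
  by rewrite coefZ coefXn.
apply: fps_div_unique => [|p].
  by rewrite qE big1 ?subr0 ?unitr1 // => i _; rewrite mulr0.
rewrite /fps_mul coef_1X_expn -[RHS](addrK (\sum_(1 <= j < n.+1)
  (if (j < p)%N then s (p - j.+1)%N else 0) *+ 'C(n, j))) -sE.
under eq_bigr => i _ do rewrite qE mulrBr mulr_sumr.
rewrite sumrB; congr (_ - _).
  rewrite (bigD1 ord_max) //= subnn mulr1 big1 ?addr0 // => i ne_i.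
  rewrite subn_eq0 leqNgt ltn_neqAle -ltnS ltn_ord andbT.
  by rewrite -(inj_eq val_inj) /= in ne_i; rewrite ne_i mulr0.
rewrite exchange_big; apply: eq_bigr => j _ /=; rewrite -[RHS]mulr_natl.
under eq_bigr => i _ do rewrite mulrCA.
rewrite -mulr_sumr; congr (_ * _); case: ltnP => [lt_jp|le_pj].
  have lt_p : (p - j.+1 < p.+1)%N by rewrite ltnS leq_subr.
  rewrite (bigD1 (Ordinal lt_p)) //= subKn // eqxx mulr1 big1 ?addr0 // => i ne_i.
  rewrite (_ : (_ == _) = false) ?mulr0 //; apply: contraNF ne_i => /eqP eij.
  by apply/eqP/val_inj; rewrite /= -eij subKn // -ltnS.
rewrite big1 // => i _; rewrite (_ : (_ == _) = false) ?mulr0 //.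
by apply/negbTE; rewrite neq_ltn ltnS (leq_trans (leq_subr _ _) le_pj).
Qed.

Lemma tor_dim_sunflower (k : fieldType) (N n : nat) (H : hypergraph N)
    (C : {set 'I_N}) (Y : 'I_n -> {set 'I_N}) (i : nat) :
  sunflower C Y (edges H) ->
  tor_dim (halg_aug k H) (restrict (halg_aug k H)) i =
  size (words (fun l : letter n => #|val l|) N i).
Proof.
move=> sunH; have [C0 Y0 _ _ _] := sunH.
have [z zC] := set0Pn _ C0.
have [v vY] := boolp.choice (fun j => elimT (set0Pn _) (Y0 j)).
apply: (@tor_dim_golod k {mpoly k[N]} (hypergraph_algebra k H) (@mpolyC N k)
  (halg_pi k H) (halg_aug k H) N n (fun j => 'X_j)
  (fun j => edge_monomial k (Y j)) (edge_monomial k C) (edge_monomial k (C :\ z))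
  z (fun j => edge_monomial k (Y j :\ v j)) v).
- exact: variables_regular.
- exact: petals_regular sunH.
- by move=> p; apply: core_regular.
- exact: edge_monomialD1.
- by move=> j; apply: edge_monomialD1.
- exact: halg_pi_surj.
- exact: halg_pi_sunflower sunH.
- by move=> j; rewrite [LHS]halg_aug_pi; apply: mevalXU.
- by move=> b; rewrite [LHS]halg_aug_pi; apply: mevalC.
- by move=> a; exists a@_0; apply: sub_const_in_ideal.
Qed.

Theorem theorem4p1 (k : fieldType) (n d a N : nat) (H : hypergraph N)
  (hn : (1 <= n)%N) (ha : (0 < a)%N) (had : (a < d)%N)
  (hH : is_hyperstar n d a H) :
  poincare_series (halg_aug k H)
    =1 poly_ratio ((1 + 'X) ^+ N)
         (1 - \sum_(1 <= i < n.+1) (betti k H i)%:R *: 'X^(i.+1))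
  /\
  poly_ratio ((1 + 'X) ^+ N)
         (1 - \sum_(1 <= i < n.+1) (betti k H i)%:R *: 'X^(i.+1))
    =1 poly_ratio ((1 + 'X) ^+ (n * (d - a) + a))
         (1 - \sum_(1 <= i < n.+1) 'C(n, i)%:R *: 'X^(i.+1)).
Proof.
have [C [Y sunH]] := hyperstar_sunflower hn ha had hH.
have bettiE : \sum_(1 <= i < n.+1) (betti k H i)%:R *: 'X^(i.+1) =
    \sum_(1 <= i < n.+1) 'C(n, i)%:R *: 'X^(i.+1) :> {poly int}.
  by apply: eq_bigr => i _; rewrite (betti_sunflower k sunH).
rewrite bettiE; split=> i; last by case: hH => <-.
by rewrite -words_series /poincare_series (tor_dim_sunflower k i sunH).
Qed.
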